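(* Let $n$ be a positive integer and let $\mathbb{S}^n$ be the standard $n$-dimensional Euclidean sphere in Euclidean $(n+1)$-space, equipped with a Tucker triangulation. Then there exists a pair of paths $(v_0,v_1,\dots,v_m)$ and $(w_0,w_1,\dots,w_m)$ in the triangulation such that: (1) the paths start at antipodal vertices and end at vertices connected by a complementary edge; (2) for each $t$, the vertices $v_t$ and $w_t$ form a Tucker pair.
   Context: Let $T$ be the free involution $T(x)=-x$ of $\mathbb{S}^n$. A triangulation of $\mathbb{S}^n$ is called a Tucker triangulation if its vertices are labeled by elements of the set $\{-1,+1,\dots,-n,+n\}$ and the triangulation is antisymmetric with respect to $T$: it is carried to itself by $T$, and a vertex labeled $k$ is mapped by $T$ to a vertex labeled $-k$. A vertex and its image under $T$ are called antipodal. An edge of a Tucker triangulation is called complementary if the sum of the labels of its endpoints is zero. A pair of points is called a Tucker pair if either the points are vertices and the sum of their labels is zero, or both points are midpoints of complementary edges. A path in a triangulation is a sequence of vertices $(v_0,v_1,\dots,v_m)$ such that for each $t$, either $v_{t+1}$ and $v_t$ are adjacent (i.e. connected by an edge), or $v_{t+1}=v_t$. *)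

(* Defs.v *)
From mathcomp Require Import all_boot all_order all_algebra.
From mathcomp Require Import all_classical all_reals all_analysis.

Set Implicit Arguments.
Unset Strict Implicit.
Unset Printing Implicit Defensive.

Import Order.TTheory GRing.Theory Num.Theory.
Import numFieldNormedType.Exports.

Local Open Scope classical_set_scope.
Local Open Scope ring_scope.

(* The norm carried by 'rV[R]_n.+1 in the library is the sup norm, hence the
   explicit Euclidean equation; the topology is the usual one. *)
Definition sphere (R : realType) (n : nat) : set 'rV[R]_n.+1 :=
  [set x | \sum_i x ord0 i ^+ 2 = 1].

Definition homeomorphism_on (S T : topologicalType) (A : set S) (B : set T)
    (f : S -> T) : Prop :=
  [/\ {within A, continuous f}, f @` A = B &
      exists g : T -> S,
        {within B, continuous g} /\ (forall x, A x -> g (f x) = x)].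

Record simplicial_complex (V : finType) := SimplicialComplex {
  simplices :> {set {set V}};
  simplex_neq0 : finset.set0 \notin simplices;
  simplex_face : forall s t : {set V},
    s \in simplices -> t \subset s -> t != finset.set0 -> t \in simplices;
  simplex_vertex : forall v : V, [set v]%SET \in simplices }.

Definition adjacent (V : finType) (K : simplicial_complex V) : rel V :=
  [rel u v | (u != v) && ([set u; v]%SET \in simplices K)].

(* The path (v_0, ..., v_m) is the sequence [:: v_0; ...; v_m]. *)
Definition edge_path (V : finType) (K : simplicial_complex V) (s : seq V) :
    bool :=
  sorted [rel u v | (u == v) || adjacent K u v] s.

(* Standard geometric realization in R^N of a complex with vertex set 'I_N:
   the vertex v is the basis vector delta_mx 0 v, and points are given by
   their barycentric coordinates. *)
Definition closed_simplex (R : realType) (N : nat) (s : {set 'I_N}) :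
    set 'rV[R]_N :=
  [set x | [/\ forall i, 0 <= x ord0 i, \sum_i x ord0 i = 1 &
               forall i, i \notin s -> x ord0 i = 0]].

Definition realization (R : realType) (N : nat)
    (K : simplicial_complex 'I_N) : set 'rV[R]_N :=
  [set x | exists2 s : {set 'I_N}, s \in simplices K & closed_simplex s x].

(* By compactness of the sphere, finite complexes suffice. *)
Record triangulation (R : realType) (n N : nat) := Triangulation {
  complex :> simplicial_complex 'I_N;
  param : 'rV[R]_N -> 'rV[R]_n.+1;
  param_homeo :
    homeomorphism_on (@realization R N complex) (@sphere R n) param }.

Section TuckerTriangulation.
Variables (R : realType) (n N : nat) (K : triangulation R n N).
Variable label : 'I_N -> int.

Definition vertex (v : 'I_N) : 'rV[R]_n.+1 := param K (delta_mx ord0 v).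

Definition midpoint (u v : 'I_N) : 'rV[R]_n.+1 :=
  param K (2^-1 *: (delta_mx ord0 u + delta_mx ord0 v)).

Definition face (s : {set 'I_N}) : set 'rV[R]_n.+1 :=
  param K @` closed_simplex s.

Definition antipodal (u v : 'I_N) : Prop := vertex v = - vertex u.

(* The antipodal map is only required to send faces onto faces; it need not
   be affine in barycentric coordinates. *)
Definition tucker_triangulation : Prop :=
  [/\ forall v, (1 <= `|label v| <= n)%N,
      forall s : {set 'I_N}, s \in simplices K ->
        exists2 t : {set 'I_N}, t \in simplices K &
          [set - x | x in face s] = face t &
      forall u, exists2 v, antipodal u v & label v = - label u].

Definition complementary_edge (u v : 'I_N) : Prop :=
  adjacent K u v /\ label u + label v = 0.

Definition tucker_pair (x y : 'rV[R]_n.+1) : Prop :=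
  (exists u v, [/\ x = vertex u, y = vertex v & label u + label v = 0]) \/
  (exists a b c d, [/\ complementary_edge a b, complementary_edge c d,
                       x = midpoint a b & y = midpoint c d]).

End TuckerTriangulation.

(* Main.v *)
Require Import Defs.
From mathcomp Require Import all_boot all_order all_algebra.
From mathcomp Require Import all_classical all_reals all_analysis.
From mathcomp Require Import zify ring lra.

Set Implicit Arguments.
Unset Strict Implicit.
Unset Printing Implicit Defensive.

(** Compose the second path with the antipodal map on the vertices: with
    u_t the antipode of w_t, the theorem asks for a walk of pairs (v_t, u_t) of
    equally labelled vertices, starting on the diagonal and ending at a pair
    where v is adjacent to the antipode of u.  Call a pair linked when such a
    walk joins it to the diagonal ([label_linked]).

    The triangulation is first traded for a cubical grid.  The inverse of the
    homeomorphism is uniformly continuous, so there is an odd map from nonzero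
    vectors of R^(n+1) to vertices which sends close vectors to equal or
    adjacent vertices ([equivariant_approximation]).  Pairs of points of the
    sphere are then parametrized by a box of dimension 2n+1: for x and u in the
    n-cube, seen as points P and U of the upper hemisphere, and a height t in
    [0, 1], take the directions of
      y = t U + (1 - t) P   and   z = t U - (1 - t) P   ([chord_end]).
    At height 1 the two points coincide, at height 0 they are antipodal.
    Replacing x by -x on the boundary of its cube exchanges y and z, and
    replacing u by -u on the boundary of its cube turns (y, z) into (-z, -y).
    With these identifications the box maps to the pairs of points of the
    sphere modulo the group of order 4 generated by the swap of the two points
    and the antipodal map, except at height 1/2 where y or z can be 0.  The
    theorem follows once a cell of the bottom face is linked ([linked_bottom]).

    Suppose that there is none.  The labels at the corners of a cell define 2n
    signs of that cell ([pair_sign]), each of them odd or even under the two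
    identifications, hence a cubical 2n-cocycle mod 2, the iterated product of
    the coboundaries of these signs ([sign_cup]); it represents a product of 2n
    characteristic classes of the group of order 4.  Four facts about it give
    the contradiction.
    - It vanishes on a 2n-cell where no label is common to the two ends
      ([disjoint_labels_sign_cup]).
    - Therefore its restriction to the linked cells is still a cocycle
      ([linked_cup_closed]): the cells with a common label on which it lives
      fall into linked and unlinked ones, and no cell has facets of both kinds.
      The cells where y or z degenerates do not matter, because the last sign is
      constant around them.
    - That restriction is invariant under the identifications of the side faces
      ([linked_cup_flipx], [linked_cup_flipu]), whose contributions cancel.
    - On the top face, where every cell is linked, it is nonzero on exactly one
      cell ([sign_cup_top]).
    Summing the cocycle condition over all top-dimensional cells leaves one
    nonzero term ([linked_bottom]).

    The swap alone would not be enough.  The differences of the n coordinates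
    of the label map vanish also at pairs without common label, both ends of
    which lie over the origin because each carries two opposite labels; these
    pairs can separate the antidiagonal from the diagonal.  There the signs of
    the second family, which record at which end both k and -k occur, take
    over.  Both families are odd under the swap, but only the first one is odd
    under the antipodal map, and it is modulo the full group of order 4 that the
    product of all the signs survives on the top face. *)

(** * Sums modulo 2 and cubical cochains *)

Reserved Notation "\xor_ ( i | P ) F"
  (at level 41, F at level 41, i, P at level 50,
   format "'[' \xor_ ( i  |  P ) '/  '  F ']'").
Notation "\xor_ ( i | P ) F" := (\big[addb/false]_(i | P%B) F%B) : bool_scope.

Lemma xor_involution (I : finType) (P : pred I) (f : I -> I) (F : I -> bool) :
  (forall i, P i -> P (f i)) -> (forall i, P i -> f (f i) = i) ->
  (forall i, P i -> f i != i) -> (forall i, P i -> F (f i) = F i) ->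
  \xor_(i | P i) F i = false.
Proof.
move=> Pf ffK fN Ff.
pose lo i := enum_rank i < enum_rank (f i).
rewrite (bigID lo) /= [X in _ (+) X](reindex_onto f f) /=; last first.
  by move=> i /andP[Pi _]; apply: ffK.
rewrite [X in _ (+) X](_ : _ = \xor_(i | P i && lo i) F i) ?addbb //.
apply: eq_big => [i|i /andP[/andP[Pfi _] /eqP fi]].
  apply/idP/idP => [/andP[/andP[Pfi] lofi] /eqP fi|/andP[Pi loi]].
    have Pi : P i by rewrite -fi; apply: Pf.
    move: lofi; rewrite /lo fi Pi -leqNgt leq_eqVlt => /orP[|//].
    by rewrite val_eqE (inj_eq enum_rank_inj) eq_sym (negbTE (fN _ Pi)).
  by rewrite Pf //= ffK // eqxx andbT /lo ffK // -leqNgt ltnW.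
by apply: Ff; rewrite -fi; apply: Pf.
Qed.

Section Cochains.
Variables (D m : nat).

(** In each coordinate, even values are the grid points and odd values the open
    unit edges between them, so that the parity pattern of a cell tells its
    dimension.  When m is odd the center m of a coordinate is an edge. *)
Definition cell := {ffun 'I_D -> 'I_(m.*2).+1}.

Implicit Types (v w p : cell) (e : 'I_D * bool).

(** The facet of v in direction [e.1], on the upper side when [e.2] holds.  It
    is meaningful only when v extends in that direction, [odd (v e.1)]. *)
Definition facet v e : cell :=
  [ffun j => if j == e.1 then inord (if e.2 then (v j).+1 else (v j).-1)
             else v j].

Definition cell_dim v : nat := #|[pred i | odd (v i)]|.

Lemma facetE v e j : odd (v e.1) ->
  facet v e j = (if j == e.1 then if e.2 then (v j).+1 else (v j).-1
                 else v j) :> nat.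
Proof.
move=> oe; rewrite ffunE; case: eqP => // ->.
rewrite inordK //; have := ltn_ord (v e.1).
by case: e.2; lia.
Qed.

Lemma odd_facet v e j : odd (v e.1) ->
  odd (facet v e j) = (j != e.1) && odd (v j).
Proof.
by move=> oe; rewrite facetE //; case: eqP => //= ->; case: e.2; lia.
Qed.

Lemma cell_dim_facet v e : odd (v e.1) -> (cell_dim (facet v e)).+1 = cell_dim v.
Proof.
move=> oe; rewrite /cell_dim [RHS](cardD1 e.1) inE oe add1n; congr _.+1.
by apply: eq_card => j; rewrite !inE odd_facet.
Qed.

Definition coboundary (B : cell -> bool) v : bool :=
  \xor_(e | odd (v e.1)) B (facet v e).

Lemma facetC v e1 e2 : odd (v e1.1) -> odd (v e2.1) -> e1.1 != e2.1 ->
  facet (facet v e1) e2 = facet (facet v e2) e1.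
Proof.
move=> o1 o2 ne; apply/ffunP => j; apply: val_inj => /=.
have o12 : odd (facet v e1 e2.1) by rewrite odd_facet // eq_sym ne.
have o21 : odd (facet v e2 e1.1) by rewrite odd_facet // ne.
rewrite (facetE _ o12) (facetE _ o21) (facetE _ o1) (facetE _ o2).
by case: (eqVneq j e1.1) => [->|_] //; rewrite (negbTE ne).
Qed.

Lemma coboundary_const v : coboundary xpredT v = false.
Proof.
apply: (@xor_involution _ _ (fun e => (e.1, ~~ e.2))) => // [[i b]|[i b]] _ //=.
  by rewrite negbK.
by rewrite xpair_eqE eqxx /=; case: b.
Qed.

(** A face of codimension 2 is reached from v through two facets, depending on
    the order in which the two directions are collapsed. *)
Lemma coboundaryK B v : coboundary (coboundary B) v = false.
Proof.
rewrite /coboundary pair_big_dep /=.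
rewrite (eq_bigl (fun q : ('I_D * bool) * ('I_D * bool) =>
  [&& odd (v q.1.1), odd (v q.2.1) & q.1.1 != q.2.1])); last first.
  move=> [e1 e2] /=; case o1: (odd (v e1.1)) => //=.
  by rewrite odd_facet // eq_sym andbC.
apply: (@xor_involution _ _ (fun q => (q.2, q.1))) =>
    [[e1 e2]|[e1 e2]|[e1 e2]|[e1 e2]] //= /and3P[ o1 o2 ne].
- by rewrite o1 o2 eq_sym.
- by apply/eqP => -[e12 _]; rewrite e12 eqxx in ne.
- by rewrite facetC // eq_sym.
Qed.

Variable s : nat -> cell -> bool.

(** The cup product of the coboundaries of the 0-cochains s 0, ..., s (j-1),
    summed over the full flags of faces of the cell.  As the product of the
    first factors is closed, multiplying it by the next sign and taking the
    coboundary amounts to multiplying it by the coboundary of that sign, as the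
    proof of [sign_cupS] shows. *)
Fixpoint sign_cup j : cell -> bool :=
  if j is j'.+1 then coboundary (fun w => s j' w && sign_cup j' w)
  else xpredT.

Lemma sign_cup_closed j v : coboundary (sign_cup j) v = false.
Proof. by case: j => [|j]; rewrite (coboundary_const, coboundaryK). Qed.

(** As the product of the first j factors is closed, the sign of v itself can be
    added to those of its facets without changing the sum. *)
Lemma sign_cupS j v : sign_cup j.+1 v ->
  exists e, [/\ odd (v e.1), sign_cup j (facet v e) & s j (facet v e) != s j v].
Proof.
have -> : sign_cup j.+1 v =
    \xor_(e | odd (v e.1)) ((s j (facet v e) (+) s j v) && sign_cup j (facet v e)).
  under [RHS]eq_bigr do rewrite andb_addl.
  rewrite big_split /= -[LHS]addbF; congr (_ (+) _).
  have := sign_cup_closed j v; rewrite /coboundary => h.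
  by case: (s j v); rewrite ?h // big1.
case: (pickP (fun e => [&& odd (v e.1), sign_cup j (facet v e)
                        & s j (facet v e) != s j v])) => [e /and3P[? ? ?] _|no].
  by exists e.
rewrite big1 // => e oe; have := no e; rewrite /= oe /=.
by case: (sign_cup _ _); rewrite ?andbF //=; do 2!case: (s j _).
Qed.

(** A nonzero value is witnessed by a full flag of faces along which the i-th
    sign changes at the i-th step. *)
Lemma sign_cup_chain j v : sign_cup j v -> cell_dim v = j ->
  exists c : nat -> cell,
    [/\ c j = v, cell_dim (c 0) = 0,
        forall i, i < j -> exists2 e, odd (c i.+1 e.1) & c i = facet (c i.+1) e
      & forall i, i < j -> s i (c i) != s i (c i.+1)].
Proof.
elim: j v => [|j IHj] v; first by exists (fun=> v); split.
move=> /sign_cupS[e [ oe Aw sw]] dv.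
have [|c [cj c0 cf cs]] := IHj (facet v e) Aw.
  by apply: succn_inj; rewrite cell_dim_facet.
exists (fun i => if i <= j then c i else v); split => [||i|i].
- by rewrite ltnn.
- by [].
- rewrite ltnS => ij; rewrite ij; case: ltnP => [/cf //|ji].
  by exists e => //; rewrite (_ : i = j) //; lia.
- rewrite ltnS => ij; rewrite ij; case: ltnP => [/cs //|ji].
  by rewrite (_ : i = j) ?cj //; lia.
Qed.

End Cochains.

(** * Corners of cells and reflections of the grid *)

Section Corners.
Variables (D m : nat).
Implicit Types (v w p q : cell D m) (e : 'I_D * bool) (Q : pred (cell D m)).
Implicit Types S : pred 'I_D.

Definition corner p v : bool :=
  [forall i, [&& ~~ odd (p i), v i <= p i + odd (v i) & p i <= v i + odd (v i)]].

Definition at_corner Q v : bool := [exists p, corner p v && Q p].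

Lemma at_cornerP Q v : reflect (exists2 p, corner p v & Q p) (at_corner Q v).
Proof.
by apply: (iffP existsP) => [[p /andP[]]|[p pv Qp]]; exists p => //; apply/andP.
Qed.

Lemma eq_at_corner Q1 Q2 v : (forall p, corner p v -> Q1 p = Q2 p) ->
  at_corner Q1 v = at_corner Q2 v.
Proof.
move=> eqQ; apply/at_cornerP/at_cornerP => -[p pv Qp]; exists p => //.
  by rewrite -eqQ.
by rewrite eqQ.
Qed.

Lemma corner_facet v e p : odd (v e.1) -> corner p (facet v e) -> corner p v.
Proof.
move=> oe /forallP pw; apply/forallP => i; have := pw i.
rewrite odd_facet // facetE //; case: eqP => //= ->; rewrite oe.
by case: e.2; lia.
Qed.

Lemma at_corner_facet Q v e : odd (v e.1) ->
  at_corner Q (facet v e) -> at_corner Q v.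
Proof.
by move=> oe /at_cornerP[p /(corner_facet oe) pv Qp]; apply/at_cornerP; exists p.
Qed.

Lemma corner_dim0 v p : cell_dim v = 0 -> corner p v = (p == v).
Proof.
move=> /card0_eq d0; have ev i : odd (v i) = false by have := d0 i.
apply/forallP/eqP => [pv|-> i]; last by rewrite ev addn0 leqnn.
by apply/ffunP => i; apply: val_inj; have := pv i; rewrite ev /=; lia.
Qed.

(** The reflection through the center in the coordinates of S. *)
Definition flip S v : cell D m := [ffun i => if S i then rev_ord (v i) else v i].

Lemma flipE S v i : flip S v i = (if S i then m.*2 - v i else v i) :> nat.
Proof. by rewrite ffunE; case: (S i) => //=; rewrite subSS. Qed.

Lemma flipK S : involutive (flip S).
Proof.
move=> v; apply/ffunP => i; apply: val_inj => /=.
by rewrite !flipE; case: (S i) => //; have := ltn_ord (v i); lia.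
Qed.

Lemma odd_flip S v i : odd (flip S v i) = odd (v i).
Proof. by rewrite flipE; case: (S i) => //; have := ltn_ord (v i); lia. Qed.

Lemma facet_flip S v e : odd (v e.1) ->
  facet (flip S v) e = flip S (facet v (e.1, S e.1 (+) e.2)).
Proof.
move=> oe; apply/ffunP => i; apply: val_inj => /=.
rewrite facetE ?odd_flip // !flipE facetE //=; case: eqP => [->|//].
case Se: (S e.1) => //=; have := ltn_ord (v e.1).
by case: e.2 => /=; lia.
Qed.

Lemma corner_flip S p v : corner (flip S p) (flip S v) = corner p v.
Proof.
apply: eq_forallb => i; rewrite !odd_flip !flipE.
by case: (S i) => //; have := ltn_ord (v i); have := ltn_ord (p i); lia.
Qed.

Lemma at_corner_flip S Q v : at_corner Q (flip S v) = at_corner (Q \o flip S) v.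
Proof.
apply/at_cornerP/at_cornerP => -[p pv Qp]; exists (flip S p).
- by rewrite -(corner_flip S) flipK.
- by rewrite /= flipK.
- by rewrite corner_flip.
- by [].
Qed.

Definition on_boundary S v : bool :=
  [exists i, S i && ((v i == 0 :> nat) || (v i == m.*2 :> nat))].

Lemma on_boundary_facet S v e : odd (v e.1) -> on_boundary S v ->
  on_boundary S (facet v e).
Proof.
move=> oe /existsP[i /andP[Si vi]]; apply/existsP; exists i.
by rewrite Si /= facetE //; case: (eqVneq i e.1) => [ie|//]; rewrite -ie in oe; lia.
Qed.

Lemma on_boundary_corner S v p : corner p v -> on_boundary S v -> on_boundary S p.
Proof.
move=> /forallP pv /existsP[i /andP[Si vi]]; apply/existsP; exists i.
by rewrite Si /=; have := pv i; lia.
Qed.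

Lemma on_boundary_flip S v : on_boundary S (flip S v) = on_boundary S v.
Proof.
apply: eq_existsb => i; rewrite flipE; case: (S i) => //=.
by have := ltn_ord (v i); lia.
Qed.

(** Invariance needs the signs to be reflected up to constants only on a family
    of cells closed under facets; the constants disappear because the product of
    the other factors is closed. *)
Lemma sign_cup_flip S (s : nat -> cell D m -> bool) (chi : nat -> bool) Q :
  (forall v e, odd (v e.1) -> Q v -> Q (facet v e)) ->
  (forall j v, Q v -> s j (flip S v) = s j v (+) chi j) ->
  forall j v, Q v -> sign_cup s j (flip S v) = sign_cup s j v.
Proof.
move=> Qf sQ; elim=> //= j IHj v Qv; rewrite /coboundary.
pose h e : 'I_D * bool := (e.1, S e.1 (+) e.2).
have hK : involutive h by case=> i b; rewrite /h /= addbA addbb addFb.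
rewrite (reindex_inj (inv_inj hK)) /=.
under eq_bigl do rewrite odd_flip.
transitivity (\xor_(e | odd (v e.1))
    ((s j (facet v e) (+) chi j) && sign_cup s j (facet v e))).
  apply: eq_bigr => e oe.
  rewrite facet_flip //= addbA addbb addFb -surjective_pairing.
  by rewrite sQ ?IHj //; apply: Qf.
under eq_bigr do rewrite andb_addl.
rewrite big_split /= -[RHS]addbF; congr (_ (+) _).
have := sign_cup_closed s j v; rewrite /coboundary.
by case: (chi j) => // _; rewrite big1.
Qed.

End Corners.

(** * The lexicographic sign *)

Section Lexsign.
Variable m : nat.

(** The side of the center m on which the first entry different from m lies.  It
    serves as the default value of all signs: it is odd under reflections, and
    once the first entries are centered, only the next one decides. *)
Fixpoint lexsign (a : seq nat) : bool :=
  if a is x :: a' then if x == m then lexsign a' else m < x else false.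

Lemma lexsign_opp a : all (leq^~ m.*2) a -> has (predC1 m) a ->
  lexsign [seq m.*2 - x | x <- a] = ~~ lexsign a.
Proof.
elim: a => //= x a IHa /andP[xm am]; case: (eqVneq x m) => [-> /= ha|ne _].
  by rewrite -{1}addnn addnK eqxx IHa.
by case: (eqVneq (m.*2 - x) m); lia.
Qed.

Lemma lexsign_first (f : nat -> nat) k j l : j < l ->
  (forall i, i < j -> f (k + i) = m) -> f (k + j) != m ->
  lexsign [seq f i | i <- iota k l] = (m < f (k + j)).
Proof.
elim: l k j => // l IHl k [|j] jl fm fj /=.
  by move: fj; rewrite addn0 => /negbTE->.
have := fm 0 isT; rewrite addn0 => ->.
rewrite eqxx (IHl k.+1 j) ?addSnnS // => i ij.
by rewrite addSnnS fm.
Qed.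

End Lexsign.

(** * The sign cochain of a labelled family of pairs *)

Definition signed_or (a b d : bool) : bool := if a (+) b then a else d.

Lemma signed_or_swap a b d : signed_or b a (~~ d) = ~~ signed_or a b d.
Proof. by case: a b d => [] [] []. Qed.

(** The grid has coordinates x in the first n places, u in the next n, and the
    height in the last one.  To a grid point p correspond two vertices [Y p] and
    [Z p] of the triangulation, approximating the ends of a chord.  Since one of
    these ends may degenerate to the origin, where no vertex approximates it,
    the predicates [tinyY], [tinyZ] mark the grid points where this end is close
    to the origin, and [smallY], [smallZ] a larger neighborhood that contains all
    cells touching the former. *)
Section Labelling.
Variables (n r : nat) (V : Type) (lab : V -> int).
Hypothesis n_gt0 : 0 < n.
Hypothesis labP : forall a, 0 < `|lab a| <= n.

Let m := r.*2.+1.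
Let cell := cell (n.*2).+1 m.
Implicit Types (v w p q : cell) (e : 'I_(n.*2).+1 * bool).

Variables (Y Z : cell -> V) (tinyY tinyZ smallY smallZ : pred cell).

Definition xblock : pred 'I_(n.*2).+1 := fun i => i < n.
Definition ublock : pred 'I_(n.*2).+1 := fun i => n <= i < n.*2.

Definition coordinate v k : nat := v (inord k).
Definition x_sign v := lexsign m [seq coordinate v k | k <- iota 0 n].
Definition u_sign v := lexsign m [seq coordinate v k | k <- iota n n].

Definition has_label (f : cell -> V) (l : int) v :=
  at_corner (fun p => lab (f p) == l) v.

(** The four predicates below refer to the sets L and L' of the labels found at
    the corners of v for Y and Z.  When L and L' are disjoint, [single_pos] and
    [single_neg] are both true exactly when k and -k lie in the same set, which
    is then recorded by [double_pos] or [double_neg].  The four are monotone in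
    v; exchanging Y and Z, as well as passing to opposite labels, permutes
    them. *)
Definition single_pos k v :=
  at_corner (fun p => (lab (Y p) == Posz k) || (lab (Z p) == - Posz k)%R) v.
Definition single_neg k v :=
  at_corner (fun p => (lab (Z p) == Posz k) || (lab (Y p) == - Posz k)%R) v.
Definition double_pos k v := has_label Y (Posz k) v && has_label Y (- Posz k)%R v.
Definition double_neg k v := has_label Z (Posz k) v && has_label Z (- Posz k)%R v.

(** The signs of index j < n test the difference of the k-th coordinates of the
    two ends, for k = j + 1; those of index n <= j < 2n - 1 tell at which end k
    and -k occur together.  The label n is not tested by a sign of the second
    family: its place, the last one, is taken by a sign which is constant on the
    cells where an end of the chord degenerates. *)
Definition pair_sign j v : bool :=
  if j < n then signed_or (single_pos j.+1 v) (single_neg j.+1 v) (x_sign v)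
  else if j < (n.*2).-1 then
    signed_or (double_pos (j - n).+1 v) (double_neg (j - n).+1 v)
      (x_sign v (+) u_sign v)
  else signed_or (at_corner smallZ v) (at_corner smallY v) (x_sign v (+) u_sign v).

Lemma has_label_facet f l v e : odd (v e.1) ->
  has_label f l (facet v e) -> has_label f l v.
Proof. exact: at_corner_facet. Qed.

Lemma at_corner_or (Q1 Q2 : pred cell) v :
  at_corner (fun p => Q1 p || Q2 p) v = at_corner Q1 v || at_corner Q2 v.
Proof.
apply/at_cornerP/orP => [[p pv /orP[]Qp]|[]/at_cornerP[p pv Qp]].
- by left; apply/at_cornerP; exists p.
- by right; apply/at_cornerP; exists p.
- by exists p; rewrite // Qp.
- by exists p; rewrite // Qp orbT.
Qed.

Lemma single_posE k v :
  single_pos k v = has_label Y (Posz k) v || has_label Z (- Posz k)%R v.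
Proof. exact: at_corner_or. Qed.

Lemma single_negE k v :
  single_neg k v = has_label Z (Posz k) v || has_label Y (- Posz k)%R v.
Proof. exact: at_corner_or. Qed.

Lemma has_label_vertex f v : cell_dim v = 0 -> has_label f (lab (f v)) v.
Proof. by move=> d0; apply/at_cornerP; exists v; rewrite ?corner_dim0. Qed.

(** Along a flag as in [sign_cup_chain] the label sets increase.  The initial
    vertex carries a label l at one end and l' <> l at the other.  If l' = -l,
    the sign of index |l| - 1 never changes.  Otherwise one of the two, say with
    absolute value k, has k < n.  For the k-th sign of the first family to change
    at its step, the opposite label must have appeared at the same end by then;
    from that moment on the k-th sign of the second family is constant, so that
    it cannot change at its own step, which comes later. *)
Lemma disjoint_labels_sign_cup v : cell_dim v = n.*2 ->
  (forall l, ~~ (has_label Y l v && has_label Z l v)) ->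
  sign_cup pair_sign n.*2 v = false.
Proof.
move=> dv disj; apply/negP => /sign_cup_chain /(_ dv) [c [cv c0 cf cs]].
have mono f l i j : i <= j <= n.*2 -> has_label f l (c i) -> has_label f l (c j).
  move=> /andP[ij jn] ci; elim: j ij jn => [|j IHj].
    by rewrite leqn0 => /eqP<-.
  rewrite leq_eqVlt => /orP[/eqP<- //|ij jn].
  have [e oe cE] := cf j jn.
  by apply: (has_label_facet oe); rewrite -cE IHj // ltnW.
have dis i l : i <= n.*2 -> has_label Y l (c i) -> has_label Z l (c i) -> False.
  move=> ni Yl Zl; move: (disj l).
  have ii : i <= n.*2 <= n.*2 by rewrite ni leqnn.
  by rewrite -cv (mono _ _ _ _ ii Yl) (mono _ _ _ _ ii Zl).
have lY := has_label_vertex Y c0; have lZ := has_label_vertex Z c0.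
have := labP (Y (c 0)); have := labP (Z (c 0)).
move: (lab _) (lab _) lY lZ => l' l lY lZ l'n ln.
have Yl i : i <= n.*2 -> has_label Y l (c i) by move=> ?; apply: (mono _ _ 0).
have Zl i : i <= n.*2 -> has_label Z l' (c i) by move=> ?; apply: (mono _ _ 0).
(* The case of a label x of absolute value k < n; sY tells at which end. *)
have step k (sY : bool) (x : int) : 0 < k < n -> `|x| = k ->
    (forall i, i <= n.*2 -> has_label (if sY then Y else Z) x (c i)) -> False.
  move=> kn xk xP.
  pose g i := has_label (if sY then Y else Z) (- x)%R (c i).
  have xE : x = Posz k \/ x = (- Posz k)%R by lia.
  have disb i l0 : i <= n.*2 -> ~~ (has_label Y l0 (c i) && has_label Z l0 (c i)).
    by move=> ni; apply/negP => /andP[]; apply: dis.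
  have fE i d : i <= n.*2 -> signed_or (single_pos k (c i)) (single_neg k (c i)) d =
      if g i then d else (sY == (0 <= x)%R).
    move=> ni; have := xP i ni; rewrite single_posE single_negE /g.
    have := disb i (Posz k) ni; have := disb i (- Posz k)%R ni.
    have -> : (0 <= x)%R = (x == Posz k) by lia.
    have : (- Posz k == Posz k)%R = false by lia.
    case: (sY); case: xE => ->; rewrite ?GRing.opprK ?eqxx => nk; rewrite ?nk;
    move: (has_label Y (Posz k) _) (has_label Y (- _)%R _)
      (has_label Z (Posz k) _) (has_label Z (- _)%R _) => [] [] [] [] //=.
  have hE i d : i <= n.*2 -> g i ->
      signed_or (double_pos k (c i)) (double_neg k (c i)) d = sY.
    move=> ni; have := xP i ni; rewrite /double_pos /double_neg /g.
    have := disb i (Posz k) ni; have := disb i (- Posz k)%R ni.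
    case: (sY); case: xE => ->; rewrite ?GRing.opprK;
    move: (has_label Y (Posz k) _) (has_label Y (- _)%R _)
      (has_label Z (Posz k) _) (has_label Z (- _)%R _) => [] [] [] [] //=.
  have gk : g k.
    have kn2 : k.-1 < n.*2 by lia.
    have := cs k.-1 kn2; rewrite /pair_sign.
    have -> : k.-1 < n by lia.
    have -> : k.-1.+1 = k by lia.
    rewrite !fE; [|lia|lia]; case gk: (g k) => //.
    have -> : g k.-1 = false; last by rewrite eqxx.
    have kk : k.-1 <= k <= n.*2 by lia.
    by case gk1: (g k.-1) => //; move: gk; rewrite /g (mono _ _ _ _ kk gk1).
  have gi i : k <= i <= n.*2 -> g i by move=> ki; apply: (mono _ _ k i ki).
  have kn2 : n + k.-1 < n.*2 by lia.
  have := cs (n + k.-1) kn2; rewrite /pair_sign ltnNge leq_addr /=.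
  have -> : n + k.-1 < n.*2.-1 by lia.
  have -> : (n + k.-1 - n).+1 = k by lia.
  by rewrite !hE ?eqxx //; first [lia | apply: gi; lia].
case: (eqVneq `|l| `|l'|) => [ll'|ll'].
  have {}ll' : l' = (- l)%R.
    have : l <> l' by move=> E; apply: (dis 0 l) => //; rewrite E.
    lia.
  have k2 : `|l|.-1 < n.*2 by lia.
  have := cs _ k2; rewrite /pair_sign.
  have -> : `|l|.-1 < n by lia.
  have -> : `|l|.-1.+1 = `|l| by lia.
  have E i d : i <= n.*2 ->
      signed_or (single_pos `|l| (c i)) (single_neg `|l| (c i)) d = (0 <= l)%R.
    move=> ni; rewrite single_posE single_negE; have := Yl i ni; have := Zl i ni.
    have := dis i l ni; have := dis i l' ni; rewrite ll'.
    have [lE|lE] : l = Posz `|l| \/ l = (- Posz `|l|)%R by lia.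
      have -> : (0 <= l)%R by lia.
      rewrite -lE; move: (has_label Y l _) (has_label Y (- _)%R _)
        (has_label Z l _) (has_label Z (- _)%R _) => [] [] [] [] //= D1 D2 _ _;
      by [case: (D1 isT isT) | case: (D2 isT isT)].
    have -> : (0 <= l)%R = false by lia.
    have -> : Posz `|l| = (- l)%R by lia.
    rewrite GRing.opprK; move: (has_label Y l _) (has_label Y (- _)%R _)
        (has_label Z l _) (has_label Z (- _)%R _) => [] [] [] [] //= D1 D2 _ _;
      by [case: (D1 isT isT) | case: (D2 isT isT)].
  by rewrite !E ?eqxx //; lia.
case: (ltnP `|l| n) => [kn|nl].
  by apply: (step `|l| true l) => //; rewrite kn andbT; case/andP: ln.
by apply: (step `|l'| false l') => //; lia.
Qed.

Lemma coordinate_flip S v k : coordinate (flip S v) k =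
  if S (inord k) then m.*2 - coordinate v k else coordinate v k.
Proof. exact: flipE. Qed.

Lemma xblock_inord k : k < (n.*2).+1 -> xblock (inord k) = (k < n).
Proof. by move=> kn; rewrite /xblock inordK. Qed.

Lemma ublock_inord k : k < (n.*2).+1 -> ublock (inord k) = (n <= k < n.*2).
Proof. by move=> kn; rewrite /ublock inordK. Qed.

Lemma lexsign_flip (S : pred 'I_(n.*2).+1) a l v : a + l <= n.*2 ->
  (forall k, k < (n.*2).+1 -> S (inord k) = (a <= k < a + l)) ->
  on_boundary S v ->
  lexsign m [seq coordinate (flip S v) k | k <- iota a l] =
  ~~ lexsign m [seq coordinate v k | k <- iota a l].
Proof.
move=> al SE /existsP[i /andP[Si vi]].
rewrite -lexsign_opp.
- rewrite -map_comp; congr lexsign; apply/eq_in_map => k.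
  by rewrite mem_iota => kl; rewrite coordinate_flip SE ?kl //; lia.
- by apply/allP => _ /mapP[k _ ->]; rewrite -ltnS ltn_ord.
- apply/hasP; exists (v i : nat); last by rewrite /=; lia.
  apply/mapP; exists (i : nat); last by rewrite /coordinate inord_val.
  by rewrite mem_iota -SE ?inord_val.
Qed.

Lemma lexsign_flip_id (S : pred 'I_(n.*2).+1) a l v : a + l <= n.*2 ->
  (forall k, a <= k < a + l -> S (inord k) = false) ->
  lexsign m [seq coordinate (flip S v) k | k <- iota a l] =
  lexsign m [seq coordinate v k | k <- iota a l].
Proof.
move=> al SE; congr lexsign; apply/eq_in_map => k.
by rewrite mem_iota => kl; rewrite coordinate_flip SE.
Qed.

Lemma x_sign_flipx v : on_boundary xblock v -> x_sign (flip xblock v) = ~~ x_sign v.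
Proof. by apply: lexsign_flip => [|k kn]; rewrite ?xblock_inord //; lia. Qed.

Lemma u_sign_flipx v : u_sign (flip xblock v) = u_sign v.
Proof. by apply: lexsign_flip_id => [|k kn]; rewrite ?xblock_inord //; lia. Qed.

Lemma x_sign_flipu v : x_sign (flip ublock v) = x_sign v.
Proof. by apply: lexsign_flip_id => [|k kn]; rewrite ?ublock_inord //; lia. Qed.

Lemma u_sign_flipu v : on_boundary ublock v -> u_sign (flip ublock v) = ~~ u_sign v.
Proof. by apply: lexsign_flip => [|k kn]; rewrite ?ublock_inord //; lia. Qed.

(** On singular cells the vertices [Y p] and [Z p] carry no information. *)
Definition singular v := at_corner (fun p => tinyY p || tinyZ p) v.

Variables (antipode : V -> V) (near conn : V -> V -> bool).
Hypothesis antipodeK : involutive antipode.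
Hypothesis lab_antipode : forall a, lab (antipode a) = (- lab a)%R.
Hypothesis connxx : forall a, conn a a.
Hypothesis conn_step : forall a a' b b', conn a b -> near a a' -> near b b' ->
  lab a' = lab b' -> conn a' b'.
Hypothesis conn_sym : forall a b, conn a b -> conn b a.
Hypothesis conn_antipode : forall a b, conn a b -> conn (antipode a) (antipode b).

Hypothesis tiny_smallY : forall v p q, corner p v -> corner q v ->
  tinyY p -> smallY q.
Hypothesis tiny_smallZ : forall v p q, corner p v -> corner q v ->
  tinyZ p -> smallZ q.
Hypothesis smallYZ : forall v p q, corner p v -> corner q v ->
  smallY p -> smallZ q -> False.
Hypothesis nearY : forall v p q, corner p v -> corner q v -> ~~ singular v ->
  near (Y p) (Y q).
Hypothesis nearZ : forall v p q, corner p v -> corner q v -> ~~ singular v ->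
  near (Z p) (Z q).

Hypothesis flipxY : forall p, on_boundary xblock p -> Y (flip xblock p) = Z p.
Hypothesis flipx_tiny : forall p, on_boundary xblock p ->
  tinyY (flip xblock p) = tinyZ p.
Hypothesis flipx_small : forall p, on_boundary xblock p ->
  smallY (flip xblock p) = smallZ p.
Hypothesis flipuY : forall p, on_boundary ublock p -> ~~ tinyZ p ->
  Y (flip ublock p) = antipode (Z p).
Hypothesis flipu_tiny : forall p, on_boundary ublock p ->
  tinyY (flip ublock p) = tinyZ p.
Hypothesis flipu_small : forall p, on_boundary ublock p ->
  smallY (flip ublock p) = smallZ p.

Hypothesis top_eq : forall p, p ord_max = m.*2 :> nat -> Y p = Z p.
Hypothesis top_not_small : forall p, p ord_max = m.*2 :> nat ->
  ~~ smallY p /\ ~~ smallZ p.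

Lemma flipxZ p : on_boundary xblock p -> Z (flip xblock p) = Y p.
Proof. by move=> bp; rewrite -flipxY ?on_boundary_flip // flipK. Qed.

Lemma flipx_tinyZ p : on_boundary xblock p -> tinyZ (flip xblock p) = tinyY p.
Proof. by move=> bp; rewrite -flipx_tiny ?on_boundary_flip // flipK. Qed.

Lemma flipx_smallZ p : on_boundary xblock p -> smallZ (flip xblock p) = smallY p.
Proof. by move=> bp; rewrite -flipx_small ?on_boundary_flip // flipK. Qed.

Lemma flipu_tinyZ p : on_boundary ublock p -> tinyZ (flip ublock p) = tinyY p.
Proof. by move=> bp; rewrite -flipu_tiny ?on_boundary_flip // flipK. Qed.

Lemma flipu_smallZ p : on_boundary ublock p -> smallZ (flip ublock p) = smallY p.
Proof. by move=> bp; rewrite -flipu_small ?on_boundary_flip // flipK. Qed.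

Lemma flipuZ p : on_boundary ublock p -> ~~ tinyY p ->
  Z (flip ublock p) = antipode (Y p).
Proof.
move=> bp Sp; rewrite -{2}(flipK ublock p) flipuY ?antipodeK //.
  by rewrite on_boundary_flip.
by rewrite flipu_tinyZ.
Qed.

Lemma singular_facet v e : odd (v e.1) -> singular (facet v e) -> singular v.
Proof. exact: at_corner_facet. Qed.

Lemma singular_flipx v : on_boundary xblock v ->
  singular (flip xblock v) = singular v.
Proof.
move=> bv; rewrite /singular at_corner_flip; apply: eq_at_corner => p pv /=.
have bp := on_boundary_corner pv bv.
by rewrite flipx_tiny // flipx_tinyZ // orbC.
Qed.

Lemma singular_flipu v : on_boundary ublock v ->
  singular (flip ublock v) = singular v.
Proof.
move=> bv; rewrite /singular at_corner_flip; apply: eq_at_corner => p pv /=.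
have bp := on_boundary_corner pv bv.
by rewrite flipu_tiny // flipu_tinyZ // orbC.
Qed.

Lemma regular_corner v p : ~~ singular v -> corner p v -> ~~ tinyY p /\ ~~ tinyZ p.
Proof.
move=> /negP sv pv; apply/andP; rewrite -negb_or; apply/negP => Sp.
by apply: sv; apply/at_cornerP; exists p.
Qed.

(** Exchanging the two ends reverses every sign. *)
Lemma pair_sign_flipx j v : on_boundary xblock v ->
  pair_sign j (flip xblock v) = pair_sign j v (+) true.
Proof.
move=> bv; rewrite /pair_sign x_sign_flipx // u_sign_flipx addbT.
have bd p pv := on_boundary_corner (p := p) pv bv.
have lY l : has_label Y l (flip xblock v) = has_label Z l v.
  rewrite /has_label at_corner_flip; apply: eq_at_corner => p pv /=.
  by rewrite flipxY ?bd.
have lZ l : has_label Z l (flip xblock v) = has_label Y l v.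
  rewrite /has_label at_corner_flip; apply: eq_at_corner => p pv /=.
  by rewrite flipxZ ?bd.
have -> : at_corner smallY (flip xblock v) = at_corner smallZ v.
  rewrite at_corner_flip; apply: eq_at_corner => p pv /=.
  by rewrite flipx_small ?bd.
have -> : at_corner smallZ (flip xblock v) = at_corner smallY v.
  rewrite at_corner_flip; apply: eq_at_corner => p pv /=.
  by rewrite flipx_smallZ ?bd.
rewrite !single_posE !single_negE /double_pos /double_neg !lY !lZ addNb.
by case: ifP => _; [|case: ifP => _]; apply: signed_or_swap.
Qed.

(** Exchanging the two ends and passing to antipodes preserves the signs of the
    first family and reverses those of the second. *)
Lemma pair_sign_flipu j v : on_boundary ublock v -> ~~ singular v ->
  pair_sign j (flip ublock v) = pair_sign j v (+) (n <= j).
Proof.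
move=> bv sv; rewrite /pair_sign x_sign_flipu u_sign_flipu //.
have bd p pv := on_boundary_corner (p := p) pv bv.
have lY l : has_label Y l (flip ublock v) = has_label Z (- l)%R v.
  rewrite /has_label at_corner_flip; apply: eq_at_corner => p pv /=.
  have [_ Sp] := regular_corner sv pv.
  by rewrite flipuY ?bd // lab_antipode GRing.eqr_oppLR.
have lZ l : has_label Z l (flip ublock v) = has_label Y (- l)%R v.
  rewrite /has_label at_corner_flip; apply: eq_at_corner => p pv /=.
  have [Sp _] := regular_corner sv pv.
  by rewrite flipuZ ?bd // lab_antipode GRing.eqr_oppLR.
have -> : at_corner smallY (flip ublock v) = at_corner smallZ v.
  rewrite at_corner_flip; apply: eq_at_corner => p pv /=.
  by rewrite flipu_small ?bd.
have -> : at_corner smallZ (flip ublock v) = at_corner smallY v.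
  rewrite at_corner_flip; apply: eq_at_corner => p pv /=.
  by rewrite flipu_smallZ ?bd.
rewrite !single_posE !single_negE /double_pos /double_neg !lY !lZ !GRing.opprK.
rewrite addbN ltnNge.
case: (n <= j) => /=.
  rewrite addbT; case: ifP => _; rewrite signed_or_swap //.
  by rewrite andbC [X in signed_or _ X]andbC.
by rewrite addbF orbC [X in signed_or _ X]orbC.
Qed.

Definition linked v : bool :=
  [exists p, exists q, [&& corner p v, corner q v & conn (Y p) (Z q)]].

Lemma linkedP v :
  reflect (exists p q, [/\ corner p v, corner q v & conn (Y p) (Z q)])
  (linked v).
Proof.
apply: (iffP existsP) => [[p /existsP[q /and3P[]]]|[p [q []]]] *.
  by exists p, q.
by exists p; apply/existsP; exists q; apply/and3P.
Qed.

Lemma linked_flipx v : on_boundary xblock v -> linked v -> linked (flip xblock v).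
Proof.
move=> bv /linkedP[p [q [pv qv c]]]; apply/linkedP.
exists (flip xblock q), (flip xblock p); rewrite !corner_flip; split=> //.
rewrite flipxY ?(on_boundary_corner qv) // flipxZ ?(on_boundary_corner pv) //.
exact: conn_sym.
Qed.

Lemma linked_flipu v : on_boundary ublock v -> ~~ singular v ->
  linked v -> linked (flip ublock v).
Proof.
move=> bv sv /linkedP[p [q [pv qv c]]]; apply/linkedP.
have [Sp _] := regular_corner sv pv; have [_ Sq] := regular_corner sv qv.
exists (flip ublock q), (flip ublock p); rewrite !corner_flip; split=> //.
rewrite flipuY ?(on_boundary_corner qv) // flipuZ ?(on_boundary_corner pv) //.
exact/conn_antipode/conn_sym.
Qed.

Definition linked_cup v : bool :=
  [&& sign_cup pair_sign n.*2 v, ~~ singular v & linked v].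

Lemma linked_cup_flipx v : on_boundary xblock v ->
  linked_cup (flip xblock v) = linked_cup v.
Proof.
move=> bv; rewrite /linked_cup singular_flipx //.
rewrite (@sign_cup_flip _ _ xblock pair_sign xpredT (on_boundary xblock)) //.
- congr [&& _, _ & _]; apply/idP/idP; last exact: linked_flipx.
  by rewrite -{2}(flipK xblock v); apply: linked_flipx; rewrite on_boundary_flip.
- by move=> w e; apply: on_boundary_facet.
- by move=> j w; apply: pair_sign_flipx.
Qed.

Lemma linked_cup_flipu v : on_boundary ublock v ->
  linked_cup (flip ublock v) = linked_cup v.
Proof.
move=> bv; rewrite /linked_cup singular_flipu //.
case sv: (singular v); first by rewrite !andbF.
rewrite (@sign_cup_flip _ _ ublock pair_sign (leq n)
  (fun w => on_boundary ublock w && ~~ singular w)) ?bv ?sv //=.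
- congr (_ && _); apply/idP/idP; last by apply: linked_flipu; rewrite ?sv.
  rewrite -{2}(flipK ublock v); apply: linked_flipu.
    by rewrite on_boundary_flip.
  by rewrite singular_flipu ?sv.
- move=> w e oe /andP[bw sw]; rewrite on_boundary_facet //=.
  by apply: contra sw; apply: singular_facet.
- by move=> j w /andP[bw sw]; apply: pair_sign_flipu.
Qed.

Lemma corner_exists v : exists p, corner p v.
Proof.
exists [ffun i => if odd (v i) then inord (v i).-1 else v i].
apply/forallP => i; rewrite ffunE; case: ifP => [ ov|->]; last first.
  by rewrite addn0 leqnn.
by rewrite inordK; have := ltn_ord (v i); lia.
Qed.

(** Near a degenerate end the sign of index 2n - 1 is determined by which of the
    two ends degenerates, as the ends of a chord are never both small. *)
Lemma pair_sign_last_singular v : singular v -> exists b, forall w,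
  (forall p, corner p w -> corner p v) -> pair_sign (n.*2).-1 w = b.
Proof.
move=> /at_cornerP[p pv Sp].
have nn : ((n.*2).-1 < n) = false by lia.
case/orP: Sp => Sp; [exists false|exists true] => w wv;
  have [q qw] := corner_exists w; rewrite /pair_sign nn ltnn.
- have -> : at_corner smallY w.
    by apply/at_cornerP; exists q => //; apply: tiny_smallY pv (wv _ qw) Sp.
  case: at_cornerP => // -[q' q'w Tq'].
  by case: (smallYZ (wv _ qw) (wv _ q'w) _ Tq'); apply: tiny_smallY pv (wv _ qw) Sp.
- have -> : at_corner smallZ w.
    by apply/at_cornerP; exists q => //; apply: tiny_smallZ pv (wv _ qw) Sp.
  case: at_cornerP => // -[q' q'w Tq'].
  by case: (smallYZ (wv _ q'w) (wv _ qw) Tq'); apply: tiny_smallZ pv (wv _ qw) Sp.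
Qed.

Lemma singular_sign_cup v e : odd (v e.1) -> singular v ->
  sign_cup pair_sign n.*2 (facet v e) = false.
Proof.
move=> oe /pair_sign_last_singular[b bE]; have n2 : n.*2 = (n.*2).-1.+1 by lia.
rewrite [X in sign_cup _ X]n2; apply/negP => /sign_cupS[e' [ oe' _]].
by rewrite !bE ?eqxx // => p; [|move/(corner_facet oe')]; apply: (corner_facet oe).
Qed.

(** The cocycle vanishes on all facets of a singular cell.  In a regular cell
    all corners give near vertices, so if the cell is linked, then so is each of
    its facets where some label is common to the two ends; if it is not linked,
    then none of its facets is.  Hence the restriction agrees on the facets
    either with the whole cocycle or with 0. *)
Lemma linked_cup_closed v : cell_dim v = (n.*2).+1 ->
  coboundary linked_cup v = false.
Proof.
move=> dv; case sv: (singular v).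
  apply: big1 => e oe; rewrite /linked_cup.
  by rewrite (singular_sign_cup oe sv).
have sf e : odd (v e.1) -> ~~ singular (facet v e).
  by move=> oe; apply: contraFN sv; apply: singular_facet.
case: (linkedP v) => [[p0 [q0 [p0v q0v c0]]]|nlv]; last first.
  apply: big1 => e oe; rewrite /linked_cup sf //=; apply/negP => /andP[_].
  move=> /linkedP[p [q [pv qv c]]]; apply: nlv; exists p, q.
  by split=> //; apply: (corner_facet oe).
rewrite -[RHS](sign_cup_closed pair_sign n.*2 v); apply: eq_bigr => e oe.
rewrite /linked_cup sf //=; case: linkedP => [_|nl]; first by rewrite andbT.
rewrite andbF disjoint_labels_sign_cup //.
  by apply: succn_inj; rewrite cell_dim_facet.
move=> l; apply/negP => /andP[/at_cornerP[p pv /eqP lp] /at_cornerP[q qv /eqP lq]].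
apply: nl; exists p, q; split=> //.
apply: (conn_step c0); last by rewrite lp lq.
- by apply: (nearY p0v (corner_facet oe pv)); rewrite sv.
- by apply: (nearZ q0v (corner_facet oe qv)); rewrite sv.
Qed.

Lemma corner_top v p : v ord_max = m.*2 :> nat -> corner p v ->
  p ord_max = m.*2 :> nat.
Proof. by move=> vt /forallP/(_ ord_max); have := ltn_ord (p ord_max); lia. Qed.

(** At the top the two ends carry the same labels, so that no label decides and
    all signs take their default values. *)
Lemma pair_sign_top j v : v ord_max = m.*2 :> nat ->
  pair_sign j v = if j < n then x_sign v else x_sign v (+) u_sign v.
Proof.
move=> vt; have YZ p pv := top_eq (@corner_top v p vt pv).
have lYZ l : has_label Y l v = has_label Z l v.
  by apply: eq_at_corner => p pv; rewrite YZ.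
have nT (T : pred cell) : (forall p, corner p v -> ~~ T p) -> at_corner T v = false.
  by move=> nT; case: at_cornerP => // -[p /nT /negP].
rewrite /pair_sign single_posE single_negE /double_pos /double_neg !lYZ !nT.
- by rewrite /signed_or ?addbb ?if_same.
- by move=> p /(corner_top vt)/top_not_small[].
- by move=> p /(corner_top vt)/top_not_small[].
Qed.

Lemma lexsign_center a : all (pred1 m) a -> lexsign m a = false.
Proof. by elim: a => //= x a IHa /andP[-> /IHa]. Qed.

Lemma pair_sign_center j v : v ord_max = m.*2 :> nat -> j < n.*2 ->
  (forall i, i < j -> coordinate v i = m) -> coordinate v j != m ->
  pair_sign j v = (m < coordinate v j).
Proof.
move=> vt jn vi vj; rewrite pair_sign_top //; case: ltnP => jn'.
  by rewrite /x_sign (@lexsign_first m (coordinate v) 0 j).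
rewrite [x_sign v]lexsign_center ?addFb.
  rewrite /u_sign (@lexsign_first m (coordinate v) n (j - n)) ?subnKC //.
    by lia.
  by move=> i ij; apply: vi; lia.
apply/allP => x /mapP[k]; rewrite mem_iota => kn ->.
by rewrite /= vi //; lia.
Qed.

(** With the lexicographic signs the cocycle can be computed: the two facets of v
    in direction i have different j-th signs only if i = j and v is centered in
    that direction, since the sign only looks at the coordinate j once the
    previous ones are centered. *)
Lemma sign_cup_top j v : v ord_max = m.*2 :> nat -> cell_dim v = j -> j <= n.*2 ->
  sign_cup pair_sign j v = [forall i : 'I_(n.*2).+1, (i < j) ==> (v i == m :> nat)].
Proof.
have m_odd : odd m by rewrite /m /= odd_double.
elim: j v => [|j IHj] v vt dv jn; first by apply/esym/forallP.
have ne e : odd (v e.1) -> e.1 != ord_max.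
  by move=> oe; apply/eqP => eE; rewrite eE vt odd_double in oe.
have cf e : odd (v e.1) -> sign_cup pair_sign j (facet v e) =
    [forall i : 'I_(n.*2).+1, (i < j) ==> (facet v e i == m :> nat)].
  move=> oe; apply: IHj; last exact: ltnW.
    by rewrite facetE // eq_sym (negbTE (ne _ oe)).
  by apply: succn_inj; rewrite cell_dim_facet.
pose jo : 'I_(n.*2).+1 := inord j.
have joE : jo = j :> nat by rewrite inordK // ltnW.
have cE w i : coordinate w i = w (inord i) by [].
have cfE e : odd (v e.1) -> (forall i : 'I_(n.*2).+1, i < j -> v i = m :> nat) ->
    sign_cup pair_sign j (facet v e) = (j <= e.1).
  move=> oe vi; rewrite cf //; apply/forallP/idP => [fi|je i].
    rewrite leqNgt; apply/negP => ej; have := fi e.1; rewrite ej /=.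
    by rewrite facetE // eqxx => /eqP fe; case: e.2 fe; lia.
  apply/implyP => ij; rewrite facetE //.
  case: (eqVneq i e.1) => [ie|_]; last by rewrite vi.
  by rewrite ie ltnNge je in ij.
have psE e : odd (v e.1) -> (forall i : 'I_(n.*2).+1, i < j -> v i = m :> nat) ->
    j <= e.1 -> (facet v e jo != m :> nat) ->
    pair_sign j (facet v e) = (m < facet v e jo).
  move=> oe vi je fj; rewrite pair_sign_center //.
    by rewrite facetE // eq_sym (negbTE (ne _ oe)).
  move=> i ij; rewrite cE facetE //.
  have iE : (inord i : 'I_(n.*2).+1) = i :> nat by rewrite inordK //; lia.
  case: eqP => [ie|_]; last by rewrite vi // iE.
  by rewrite -ie iE in je; lia.
transitivity ([forall i : 'I_(n.*2).+1, (i < j) ==> (v i == m :> nat)]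
              && (v jo == m :> nat)); last first.
  apply/andP/forallP => [[/forallP vi vj] i|vi].
    apply/implyP; rewrite ltnS leq_eqVlt => /orP[/eqP ij|ij].
      by rewrite (_ : i = jo) //; apply: val_inj => /=; rewrite joE.
    by have := vi i; rewrite ij.
  split; last by have := vi jo; rewrite joE ltnSn.
  apply/forallP => i; apply/implyP => ij; have := vi i.
  by rewrite ltnW.
rewrite /= /coboundary.
case: (boolP [forall i : 'I_(n.*2).+1, _]) => [/forallP vi|] /=; last first.
  rewrite negb_forall => /existsP[i]; rewrite negb_imply => /andP[ij vi].
  apply: big1 => e oe; rewrite cf //; apply/negP => /andP[_ /forallP/(_ i)].
  rewrite ij facetE //=.
  case: (eqVneq i e.1) => [ie|_]; last by rewrite (negbTE vi).
  by rewrite ie; case: e.2; lia.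
have {}vi (i : 'I_(n.*2).+1) : i < j -> v i = m :> nat.
  by move=> ij; have := vi i; rewrite ij => /eqP.
case: (eqVneq (v jo : nat) m) => [vj|vj].
  have ojo : odd (v jo) by rewrite vj.
  (* Since v has dimension j + 1, the directions 0, ..., j are all its edges. *)
  have oddE : [pred i : 'I_(n.*2).+1 | i <= j] =i [pred i | odd (v i)].
    apply/subset_cardP; last first.
      apply/fintype.subsetP => i; rewrite !inE leq_eqVlt => /orP[/eqP ij|/vi ->//].
      by rewrite (_ : i = jo) //; apply: val_inj => /=; rewrite joE.
    have jn' : j.+1 <= (n.*2).+1 by apply: ltnW.
    rewrite -[RHS]/(cell_dim v) dv -sum1_card -[RHS](card_ord j.+1) -sum1_card.
    by rewrite [RHS](big_ord_widen _ (fun=> 1) jn').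
  have fjo b : facet v (jo, b) jo = (if b then m.+1 else m.-1) :> nat.
    by rewrite facetE //= eqxx vj.
  rewrite (bigD1 (jo, true)) //= cfE //= joE leqnn psE //= ?joE // fjo //;
    last by lia.
  rewrite ltnSn big1 // => -[i b] /andP[ oi /= ib]; rewrite cfE //=.
  have := oddE i; rewrite !inE oi => ij; case: leqP => ji; rewrite ?andbF //.
  have ijo : i = jo by apply: val_inj => /=; rewrite joE; lia.
  case: b ib oi; rewrite ijo ?eqxx // => _ /= _.
  by rewrite psE //= ?joE // fjo; lia.
apply: (@xor_involution _ _ (fun e => (e.1, ~~ e.2)))
  => [[i b]|[i b]|[i b]|[i b]] //= oi.
- by rewrite negbK.
- by rewrite xpair_eqE eqxx /=; case: (b).
rewrite !cfE //=; case ji: (j <= i); last by rewrite !andbF.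
have fj b' : facet v (i, b') jo =
    (if jo == i then if b' then (v jo).+1 else (v jo).-1 else v jo) :> nat.
  by rewrite facetE //=; case: eqP => [->|].
have fjm b' : facet v (i, b') jo != m :> nat.
  rewrite fj; case: (eqVneq jo i) => [ij|//]; move: oi; rewrite -ij => oj.
  by case: b'; lia.
rewrite !psE // !fj; case: (eqVneq jo i) => [ij|//]; move: oi; rewrite -ij => oj.
by case: (b) => /=; lia.
Qed.

(** The position, along its own direction, of the facet q.2 of the cell q.1. *)
Definition facet_value (q : cell * ('I_(n.*2).+1 * bool)) : nat :=
  facet q.1 q.2 q.2.1.

Lemma facet_valueE v i b : odd (v i) ->
  facet_value (v, (i, b)) = if b then (v i).+1 else (v i).-1.
Proof. by move=> oi; rewrite /facet_value /= facetE //= eqxx. Qed.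

Definition all_edges v : bool := [forall i, odd (v i)].

Lemma all_edgesP v : all_edges v -> cell_dim v = (n.*2).+1.
Proof.
move=> /forallP ov; rewrite /cell_dim -[RHS](card_ord (n.*2).+1).
by apply: eq_card => i; rewrite !inE ov.
Qed.

Lemma xor_all_facets :
  \xor_(q | all_edges q.1) linked_cup (facet q.1 q.2) = false.
Proof.
transitivity (\xor_(v | all_edges v) coboundary linked_cup v).
  rewrite /coboundary pair_big_dep /=; apply: eq_bigl => -[v e] /=.
  by rewrite /all_edges; case: (boolP [forall i, odd (v i)]) => //= /forallP->.
by apply: big1 => v /all_edgesP; apply: linked_cup_closed.
Qed.

(** An inner facet is shared by two neighboring cells. *)
Lemma xor_inner_facets :
  \xor_(q | all_edges q.1 && (0 < facet_value q < m.*2))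
     linked_cup (facet q.1 q.2) = false.
Proof.
pose shift (v : cell) (e : 'I_(n.*2).+1 * bool) : cell :=
  [ffun j => if j == e.1 then inord (if e.2 then (v j).+2 else (v j).-2) else v j].
have shiftE v i b j : odd (v i) -> 0 < facet_value (v, (i, b)) < m.*2 ->
    shift v (i, b) j =
    (if j == i then if b then (v j).+2 else (v j).-2 else v j) :> nat.
  move=> oi; rewrite facet_valueE // ffunE /=; case: eqP => // -> vi.
  by rewrite inordK //; have := ltn_ord (v i); case: b vi; lia.
pose f (q : cell * ('I_(n.*2).+1 * bool)) := (shift q.1 q.2, (q.2.1, ~~ q.2.2)).
apply: (xor_involution (f := f))
  => [[v [i b]]|[v [i b]]|[v [i b]]|[v [i b]]] /= /andP[ ov vi];
  have oi := forallP ov i.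
- have os : all_edges (shift v (i, b)).
    apply/forallP => j; rewrite shiftE //; have := forallP ov j.
    case: (eqVneq j i) vi => [->|//].
    by rewrite facet_valueE //; case: (b) => /=; lia.
  rewrite os facet_valueE ?(forallP os) // shiftE // eqxx.
  by move: vi; rewrite facet_valueE //; case: (b) => /=; lia.
- congr (_, (_, _)); last exact: negbK.
  apply/ffunP => j; apply: val_inj; rewrite ffunE /=; case: eqP => [->|ji].
    rewrite shiftE // eqxx inordK.
      by move: vi; rewrite facet_valueE //; case: (b) => /=; lia.
    have := ltn_ord (v i); move: vi; rewrite facet_valueE //.
    by case: (b) => /=; lia.
  by rewrite shiftE //; case: eqP.
- by rewrite !xpair_eqE eqxx /=; case: (b); rewrite andbF.
congr linked_cup; apply/ffunP => j; apply: val_inj.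
have os : odd (shift v (i, b) i).
  rewrite shiftE // eqxx; move: vi; rewrite facet_valueE //.
  by case: (b) => /=; lia.
rewrite /= !facetE //= shiftE //; case: eqP => [->|//].
by move: vi; rewrite facet_valueE //; case: (b) => /=; lia.
Qed.

(** Opposite side facets are exchanged by the reflection of the x or of the u
    coordinates. *)
Lemma xor_side_facets :
  \xor_(q | [&& all_edges q.1, ~~ (0 < facet_value q < m.*2) & q.2.1 != ord_max])
     linked_cup (facet q.1 q.2) = false.
Proof.
pose S (i : 'I_(n.*2).+1) := if i < n then xblock else ublock.
have SE i : i != ord_max -> S i i.
  rewrite /S /xblock /ublock -val_eqE /= => ne; have := ltn_ord i.
  by case: (ltnP i n) => //; lia.
pose f (q : cell * ('I_(n.*2).+1 * bool)) :=
  (flip (S q.2.1) q.1, (q.2.1, ~~ q.2.2)).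
apply: (xor_involution (f := f))
  => [[v [i b]]|[v [i b]]|[v [i b]]|[v [i b]]] /= /and3P[ ov vi ne];
  have oi := forallP ov i; have Si := SE i ne.
- have os : all_edges (flip (S i) v).
    by apply/forallP => j; rewrite odd_flip (forallP ov).
  rewrite os ne andbT facet_valueE ?(forallP os) // flipE Si.
  by move: vi; rewrite facet_valueE //; have := ltn_ord (v i); case: (b) => /=; lia.
- by rewrite /f /= flipK negbK.
- by rewrite !xpair_eqE eqxx /=; case: (b); rewrite andbF.
rewrite facet_flip //= Si addTb negbK.
have : on_boundary (S i) (facet v (i, b)).
  apply/existsP; exists i; rewrite Si /= -/(facet_value (v, (i, b))).
  by move: vi; rewrite facet_valueE //; have := ltn_ord (v i); case: (b) => /=; lia.
by rewrite /S; case: ifP => _; [apply: linked_cup_flipx | apply: linked_cup_flipu].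
Qed.

(** Only the top and bottom facets remain in the sum.  All top cells are linked
    because the two ends are equal there, so the top contributes 1, and the
    bottom cannot contribute 0. *)
Lemma linked_bottom :
  exists v, [/\ v ord_max = 0 :> nat, ~~ singular v & linked v].
Proof.
case: (pickP (fun v => [&& v ord_max == 0 :> nat, ~~ singular v & linked v]))
  => [v /and3P[/eqP]|none]; first by exists v.
exfalso.
pose pairs := (cell * ('I_(n.*2).+1 * bool))%type.
have := xor_all_facets.
rewrite (bigID (fun q : pairs => 0 < facet_value q < m.*2)) /=.
rewrite xor_inner_facets addFb (bigID (fun q : pairs => q.2.1 != ord_max)) /=.
under eq_bigl do rewrite -andbA.
rewrite xor_side_facets addFb.
pose v0 : cell := [ffun i => inord (if i == ord_max then (m.*2).-1 else m)].
have v0E i : v0 i = (if i == ord_max then (m.*2).-1 else m) :> nat.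
  by rewrite ffunE inordK //; case: eqP => _; lia.
have m_odd : odd m by rewrite /m /= odd_double.
have ov0 : all_edges v0 by apply/forallP => i; rewrite v0E; case: eqP; lia.
pose q0 := (v0, (ord_max : 'I_(n.*2).+1, true)).
have top0 : facet v0 (ord_max, true) ord_max = m.*2 :> nat.
  by rewrite facetE ?(forallP ov0) //= eqxx v0E eqxx; lia.
rewrite (bigD1 q0) /=; last first.
  rewrite ov0 negbK eqxx andbT facet_valueE ?(forallP ov0) // v0E eqxx; lia.
have dimf v e : all_edges v -> cell_dim (facet v e) = n.*2.
  move=> ov; apply: succn_inj; rewrite cell_dim_facet ?(forallP ov) //.
  exact: all_edgesP.
have -> : linked_cup (facet v0 (ord_max, true)).
  apply/and3P; split.
  - rewrite sign_cup_top ?dimf //; apply/forallP => i; apply/implyP => i2.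
    have ni : (i == ord_max) = false by rewrite -val_eqE /= ltn_eqF.
    by rewrite facetE ?(forallP ov0) //= ni v0E ni.
  - apply/negP => /at_cornerP[p pv].
    have [Tp Tp'] := top_not_small (corner_top top0 pv).
    by case/orP=> [/(tiny_smallY pv pv)|/(tiny_smallZ pv pv)]; apply/negP.
  - have [p pv] := corner_exists (facet v0 (ord_max, true)).
    apply/linkedP; exists p, p; split=> //.
    by rewrite (top_eq (corner_top top0 pv)).
rewrite big1 //= => -[v [i b]] /= /andP[/andP[/andP[ ov vi] /negPn/eqP iE] ne].
move: vi ne; rewrite {}iE /q0 => vi ne; have oi := forallP ov ord_max.
have fE : facet v (ord_max, b) ord_max = facet_value (v, (ord_max, b)) :> nat by [].
case: b => [|] in vi ne fE *; rewrite facet_valueE // in vi fE.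
- have ft : facet v (ord_max, true) ord_max = m.*2 :> nat.
    by rewrite fE; have := ltn_ord (v ord_max); lia.
  rewrite /linked_cup sign_cup_top ?dimf //; apply/negP => /andP[/forallP fm _].
  case/negP: ne; rewrite !xpair_eqE !eqxx !andbT; apply/eqP/ffunP => k.
  apply: val_inj; rewrite /= v0E; case: (eqVneq k ord_max) => [->|nk].
    by have := ltn_ord (v ord_max); lia.
  have kn : k < n.*2.
    by have := ltn_ord k; move: nk; rewrite -val_eqE /=; lia.
  by have := fm k; rewrite kn /= facetE //= (negbTE nk) => /eqP.
have fb : facet v (ord_max, false) ord_max = 0 :> nat.
  by rewrite fE; have := ltn_ord (v ord_max); lia.
have := none (facet v (ord_max, false)); rewrite fb eqxx /= /linked_cup.
by move=> ->; rewrite andbF.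
Qed.

End Labelling.

Import Order.TTheory GRing.Theory Num.Theory.
Import numFieldNormedType.Exports.

(** * Uniform continuity and radial projection *)

Section Uniform.
Local Open Scope classical_set_scope.
Local Open Scope ring_scope.
Variable R : realType.

Lemma compact_uniformly_continuous (U V : normedModType R) (A : set U)
    (f : U -> V) :
  compact A ->
  (forall x, A x -> forall e, 0 < e ->
     exists2 d, 0 < d & forall y, A y -> `|x - y| < d -> `|f x - f y| < e) ->
  forall e, 0 < e -> exists2 d, 0 < d &
    forall x y, A x -> A y -> `|x - y| < d -> `|f x - f y| < e.
Proof.
move=> /compact_near_coveringP/near_covering_withinP cA fc e e0.
pose P (d : R) x := forall y, A y -> `|x - y| < d -> `|f x - f y| < e.
have [] := @filter_ex _ (0^'+ : set_system R) _ (fun d => 0 < d /\ A `<=` P d).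
  apply: filterI; first exact: nbhs_right_gt.
  apply: (cA R (0^'+) P _) => x Ax.
  have [d d0 fd] := fc x Ax (e / 2) (divr_gt0 e0 (ltr0n _ 2)).
  have d20 : 0 < d / 2 by rewrite divr_gt0.
  exists (ball x (d / 2), [set d' | d' < d / 2]) => /=.
    by split; [exact: nbhsx_ballx | exact: nbhs_right_lt].
  move=> [x' d'] /= [xx' d'd] Ax' y Ay x'y.
  move: xx'; rewrite -ball_normE /= => xx'.
  have xy : `|x - y| < d.
    have := ler_distD x' x y; lra.
  have h1 := fd _ Ax' (lt_trans xx' _); have h2 := fd _ Ay xy.
  have := ler_distD (f x) (f x') (f y); rewrite (distrC (f x') (f x)).
  have := h1 ltac:(lra); lra.
by move=> d [d0 Ad]; exists d => // x y Ax; apply: Ad.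
Qed.

Lemma within_continuousE (U V : normedModType R) (A : set U) (f : U -> V) x :
  {within A, continuous f} -> A x -> forall e, 0 < e ->
  exists2 d, 0 < d & forall y, A y -> `|x - y| < d -> `|f x - f y| < e.
Proof.
move=> /subspace_continuousP/(_ x) fc Ax e e0.
have /cvgrPdist_lt/(_ _ e0) := fc Ax.
move=> /nbhs_ballP[d d0 dP]; exists d => // y Ay xy.
by apply: dP => //; rewrite -ball_normE.
Qed.

Variable n : nat.

Definition euclid (y : 'rV[R]_n.+1) : R := Num.sqrt (\sum_i y ord0 i ^+ 2).

Definition direction (y : 'rV[R]_n.+1) := (euclid y)^-1 *: y.

Lemma euclid_gt0 y : y != 0 -> 0 < euclid y.
Proof.
move=> y0; rewrite sqrtr_gt0 lt_neqAle sumr_ge0 ?andbT => [|i _];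
  last exact: sqr_ge0.
apply: contra y0 => /eqP/esym/eqP; rewrite psumr_eq0 => [/allP y0|i _];
  last exact: sqr_ge0.
apply/eqP/rowP => i; rewrite mxE; apply/eqP.
by rewrite -sqrf_eq0; apply: y0; rewrite mem_index_enum.
Qed.

Lemma direction_sphere y : y != 0 -> sphere (direction y).
Proof.
move=> y0; rewrite /sphere /=; under eq_bigr do rewrite mxE exprMn.
rewrite -mulr_sumr -[X in _ * X]sqr_sqrtr ?sumr_ge0 // => [|i _];
  last exact: sqr_ge0.
by rewrite -exprMn mulVf ?expr1n // gt_eqF // euclid_gt0.
Qed.

Lemma directionN y : direction (- y) = - direction y.
Proof.
rewrite /direction scalerN /euclid; do 2!congr (_ _).
by congr (_^-1 *: _); congr Num.sqrt; apply: eq_bigr => i _; rewrite mxE sqrrN.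
Qed.

Lemma euclid_continuous : continuous euclid.
Proof.
move=> y.
apply: (continuous_comp (f := fun y : 'rV[R]_n.+1 => \sum_i y ord0 i ^+ 2));
  last exact: sqrt_continuous.
rewrite /continuous_at unlock /=.
elim: (index_enum _) => [|i r IHr] /=; first exact: (@cvg_cst _ _ _ (nbhs y)).
apply: (@cvgD _ _ _ (nbhs y)) => //.
by apply: (@cvgM _ _ (nbhs y)); apply: coord_continuous.
Qed.

Lemma direction_continuous y : y != 0 -> {for y, continuous direction}.
Proof.
move=> y0; apply: (@cvgZ _ _ _ (nbhs y)); last exact: cvg_id.
apply: (@cvgV _ _ (nbhs y)); last exact: euclid_continuous.
by rewrite gt_eqF // euclid_gt0.
Qed.

End Uniform.

(** * An odd approximation of the sphere by vertices *)

Section Vertices.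
Local Open Scope classical_set_scope.
Local Open Scope ring_scope.
Variables (R : realType) (n N : nat) (K : triangulation R n N).
Variable label : 'I_N -> int.
Hypothesis hK : tucker_triangulation K label.
Variable g : 'rV[R]_n.+1 -> 'rV[R]_N.
Hypothesis gK : forall a, realization K a -> g (param K a) = a.

Lemma param_onto b : sphere b -> realization K (g b) /\ param K (g b) = b.
Proof.
have [_ <- _] := param_homeo K => -[a aK <-].
by rewrite gK.
Qed.

Lemma sphereN (b : 'rV[R]_n.+1) : sphere b -> sphere (- b).
Proof.
by rewrite /sphere /= => <-; apply: eq_bigr => i _; rewrite mxE sqrrN.
Qed.

Lemma delta_closed_simplex (s : {set 'I_N}) v : v \in s ->
  closed_simplex s (delta_mx ord0 v : 'rV[R]_N).
Proof.
move=> vs; split=> [i||i]; rewrite ?mxE.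
- by case: (_ && _).
- rewrite (bigD1 v) //= mxE !eqxx big1 ?addr0 // => i iv.
  by rewrite mxE (negbTE iv).
- by case: (eqVneq i v) => [->|//]; rewrite vs.
Qed.

Lemma realization_vertex v : realization K (delta_mx ord0 v : 'rV[R]_N).
Proof.
exists [set v]%SET; first exact: simplex_vertex.
by apply: delta_closed_simplex; rewrite inE.
Qed.

Lemma vertex_inj : injective (vertex K).
Proof.
move=> u v /(congr1 g); rewrite /vertex !gK; try exact: realization_vertex.
move=> /rowP/(_ u); rewrite !mxE !eqxx; case: (eqVneq u v) => //= _ /eqP.
by rewrite oner_eq0.
Qed.

Definition near_vertices (u v : 'I_N) : bool := (u == v) || Defs.adjacent K u v.

Definition antipode (u : 'I_N) : 'I_N :=
  s2val (cid2 (let: And3 _ _ h := hK in h u)).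

Lemma antipodeP u : antipodal K u (antipode u).
Proof. by rewrite /antipode; case: (cid2 _). Qed.

Lemma label_antipode u : label (antipode u) = - label u.
Proof. by rewrite /antipode; case: (cid2 _). Qed.

Lemma antipodeK : involutive antipode.
Proof. by move=> u; apply: vertex_inj; rewrite !antipodeP opprK. Qed.

Definition support (b : 'rV[R]_n.+1) : {set 'I_N} := [set i | 0 < g b ord0 i]%SET.

Lemma support_simplex b : sphere b ->
  support b \in simplices K /\ closed_simplex (support b) (g b).
Proof.
move=> /param_onto[[s sK [g0 g1 gs]] _].
have z i : i \notin support b -> g b ord0 i = 0.
  by rewrite inE -leNgt => gi; apply/eqP; rewrite eq_le gi g0.
split; last by split.
apply: (simplex_face sK).
  apply/fintype.subsetP => i; rewrite inE; apply: contraLR => /gs ->.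
  by rewrite ltxx.
apply/eqP => s0; move: g1; rewrite big1 => [/esym/eqP|i _].
  by rewrite oner_eq0.
by apply: z; rewrite s0 inE.
Qed.

Lemma near_support b i j : sphere b -> i \in support b -> j \in support b ->
  near_vertices i j.
Proof.
move=> /support_simplex[sK _] ib jb; rewrite /near_vertices /Defs.adjacent /=.
case: eqVneq => //= _; apply: (simplex_face sK).
  by apply/fintype.subsetP => k; rewrite in_set2 => /orP[]/eqP->.
by apply/set0Pn; exists i; rewrite !inE eqxx.
Qed.

(** The antipodal map is not supposed to be affine on simplices.  It is however a
    bijection that sends faces to faces, hence the carrier of a point to the
    carrier of the antipodal point: the smallest face containing - b goes to a
    face containing b, therefore containing the vertex i. *)
Lemma support_antipode b i : sphere b -> i \in support b ->
  antipode i \in support (- b).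
Proof.
move=> sb ib; have sNb := sphereN sb.
have [tK gt] := support_simplex sNb.
have [_ /(_ _ tK)[s sK] faceE _] := hK.
have : face K s b.
  rewrite -faceE; exists (- b); last by rewrite opprK.
  by exists (g (- b)) => //; have [] := param_onto sNb.
move=> [a sa ab]; have ga : g b = a by rewrite -ab gK //; exists s.
have is_ : i \in s.
  case: sa => _ _ sa; case: (boolP (i \in s)) => // /sa.
  by rewrite -ga => gi; move: ib; rewrite inE gi ltxx.
have : face K s (vertex K i).
  by exists (delta_mx ord0 i) => //; apply: delta_closed_simplex.
rewrite -faceE => -[w [c tc cw] wi].
have : c = delta_mx ord0 (antipode i).
  rewrite -(gK (realization_vertex (antipode i))) -/(vertex K (antipode i)).
  rewrite antipodeP -wi opprK -cw gK //.
  by exists (support (- b)).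
case: tc => _ _ tc cE; case: (boolP (antipode i \in support (- b))) => // /tc /eqP.
by rewrite cE mxE !eqxx oner_eq0.
Qed.

(** The endpoints of an edge are in the carrier of its midpoint, so their
    antipodes are in the carrier of the antipode of the midpoint. *)
Lemma near_antipode u v : near_vertices u v ->
  near_vertices (antipode u) (antipode v).
Proof.
case/orP => [/eqP->|uv]; first by rewrite /near_vertices eqxx.
pose a : 'rV[R]_N := 2^-1 *: (delta_mx ord0 u + delta_mx ord0 v).
have [uv' suv] := andP uv.
have ra : realization K a.
  have [u0 u1 us] := delta_closed_simplex (set21 u v).
  have [v0 v1 vs] := delta_closed_simplex (set22 u v).
  exists [set u; v]%SET => //; split=> [i||i iuv].
  - by rewrite !mxE mulr_ge0 // addr_ge0.
  - under eq_bigr do rewrite mxE mxE.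
    by rewrite -mulr_sumr big_split /= u1 v1 mulVf.
  - have := us i iuv; have := vs i iuv; rewrite !mxE => -> ->.
    by rewrite addr0 mulr0.
have sa : sphere (param K a) by have [_ <- _] := param_homeo K; exists a.
have in_supp w : w \in [set u; v]%SET -> w \in support (param K a).
  rewrite in_set2 => wuv; rewrite inE gK // !mxE mulr_gt0 //.
  by case/orP: wuv => /eqP->; rewrite !eqxx /=; case: (_ == _) => /=; lra.
by apply: (near_support (sphereN sa) (support_antipode sa (in_supp u _))
  (support_antipode sa (in_supp v _))); rewrite in_set2 eqxx ?orbT.
Qed.

Variable i0 : 'I_N.

Definition peak (b : 'rV[R]_n.+1) : 'I_N :=
  odflt i0 [pick i | N%:R^-1 <= g b ord0 i].

Lemma peakP b : sphere b -> N%:R^-1 <= g b ord0 (peak b).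
Proof.
move=> sb; rewrite /peak; case: pickP => //= small.
have N0 : 0 < N%:R :> R by rewrite ltr0n (leq_ltn_trans _ (ltn_ord i0)).
have [[s _ [_ g1 _]] _] := param_onto sb.
have : \sum_(i < N) (g b ord0 i : R) < \sum_(i < N) N%:R^-1.
  apply: ltr_sum => [|i _]; last by rewrite ltNge small.
  by apply/hasP; exists i0; rewrite ?mem_index_enum.
by rewrite g1 sumr_const card_ord -[_ *+ _]mulr_natr mulVf ?gt_eqF // ltxx.
Qed.

(** A choice of one vector in each pair of opposite nonzero vectors. *)
Definition upper (y : 'rV[R]_n.+1) : bool :=
  xget 0 [set z | z = y \/ z = - y] == y.

Lemma upperN y : y != 0 -> upper (- y) = ~~ upper y.
Proof.
move=> y0; rewrite /upper opprK.
have -> : [set z | z = - y \/ z = y] = [set z | z = y \/ z = - y].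
  by apply/seteqP; split=> z /= []; auto.
have yN : (y == - y) = false.
  apply/negP => /eqP yN; move: y0; rewrite -subr_eq0 subr0.
  have : y + y == 0 by rewrite {1}yN addNr.
  by rewrite -mulr2n -scaler_nat scaler_eq0 pnatr_eq0 /= => ->.
case: xgetP => [z _ /= [->|->]|/(_ y)[]]; last by left.
  by rewrite eqxx yN.
by rewrite eqxx eq_sym yN.
Qed.

(** The vertex of largest barycentric coordinate does not commute with the
    antipodal map, so it is used on one half of the sphere only and carried to
    the other half. *)
Definition sphere_vertex (y : 'rV[R]_n.+1) : 'I_N :=
  if upper y then peak (direction y) else antipode (peak (direction (- y))).

Lemma sphere_vertexN y : y != 0 -> sphere_vertex (- y) = antipode (sphere_vertex y).
Proof.
move=> y0; rewrite /sphere_vertex upperN // opprK.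
by case: (upper y); rewrite ?antipodeK.
Qed.

(** A barycentric coordinate at least 1/N stays positive under a change smaller
    than 1/N. *)
Lemma support_peak b b' : sphere b -> `|g b - g b'| < N%:R^-1 ->
  peak b \in support b'.
Proof.
move=> sb bb'; have gb := peakP sb.
rewrite inE; have : `|(g b - g b') ord0 (peak b)| < N%:R^-1.
  apply: le_lt_trans bb'.
  rewrite [leRHS]/Num.norm /= mx_normrE; apply/bigmax_geP; right => /=.
  by exists (ord0, peak b).
by rewrite !mxE ltr_norml => /andP[_]; lra.
Qed.

Lemma sphere_vertex_support y : y != 0 ->
  sphere_vertex y \in support (direction y).
Proof.
move=> y0; have N0 : 0 < N%:R^-1 :> R.
  by rewrite invr_gt0 ltr0n (leq_ltn_trans _ (ltn_ord i0)).
have ps b : sphere b -> peak b \in support b.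
  by move=> sb; apply: support_peak; rewrite ?subrr ?normr0.
rewrite /sphere_vertex; case: ifP => _; first exact/ps/direction_sphere.
have -> : direction y = - direction (- y) by rewrite directionN opprK.
apply: support_antipode.
  by apply: direction_sphere; rewrite oppr_eq0.
by apply/ps/direction_sphere; rewrite oppr_eq0.
Qed.

(** As soon as one of the two vectors is in the upper half, the vertex chosen for
    it is also in the carrier of the other, together with the vertex chosen for
    that one.  Otherwise pass to the opposite vectors. *)
Lemma sphere_vertex_near y y' : y != 0 -> y' != 0 ->
  `|g (direction y) - g (direction y')| < N%:R^-1 ->
  `|g (direction (- y)) - g (direction (- y'))| < N%:R^-1 ->
  near_vertices (sphere_vertex y) (sphere_vertex y').
Proof.
have main z z' : z != 0 -> z' != 0 -> upper z ->
    `|g (direction z) - g (direction z')| < N%:R^-1 ->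
    near_vertices (sphere_vertex z) (sphere_vertex z').
  move=> z0 z'0 uz zz'; apply: (near_support (direction_sphere z'0)).
    by rewrite /sphere_vertex uz support_peak //; apply: direction_sphere.
  exact: sphere_vertex_support.
move=> y0 y'0 yy' yyN'.
case uy: (upper y); first exact: main.
rewrite -[y]opprK -[y']opprK ![sphere_vertex (- - _)]sphere_vertexN ?oppr_eq0 //.
by apply/near_antipode/main; rewrite ?oppr_eq0 // upperN // uy.
Qed.

End Vertices.

Section Approximation.
Local Open Scope classical_set_scope.
Local Open Scope ring_scope.
Variables (R : realType) (n N : nat) (K : triangulation R n N).
Variable label : 'I_N -> int.
Hypothesis hK : tucker_triangulation K label.

(** The inverse homeomorphism composed with the radial projection is uniformly
    continuous on the compact annulus eps <= |y| <= 1. *)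
Lemma equivariant_approximation (eps : R) : 0 < eps ->
  exists (phi : 'rV[R]_n.+1 -> 'I_N) (d : R), [/\ 0 < d,
    forall y, y != 0 -> phi (- y) = antipode hK (phi y) &
    forall y y', eps <= `|y| <= 1 -> eps <= `|y'| <= 1 -> `|y - y'| < d ->
      near_vertices K (phi y) (phi y')].
Proof.
move=> eps0; have [_ fK [g [gc gK]]] := param_homeo K.
have [a [s sK [_ a1 _]] _] : (param K @` realization K) (delta_mx ord0 ord0).
  rewrite fK /sphere /= (bigD1 ord0) //= mxE !eqxx expr1n big1 ?addr0 // => i i0.
  by rewrite mxE (negbTE i0) andbF expr0n.
have i0 : 'I_N.
  case: N a a1 {s sK} => [|N'] a a1; last exact: ord0.
  by exfalso; move: a1; rewrite big_ord0 => /esym/eqP; rewrite oner_eq0.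
pose A : set 'rV[R]_n.+1 := [set y | eps <= `|y| <= 1].
have A0 y : A y -> y != 0.
  by move=> /andP[ey _]; rewrite -normr_gt0 (lt_le_trans eps0).
have cA : compact A.
  apply: bounded_closed_compact.
    exists 1; split=> // M M1 y /andP[_ /le_trans]; apply; exact: ltW.
  have -> : A = (fun y => `|y|) @^-1` `[eps, 1].
    by apply/seteqP; split=> y /=; rewrite /A /= in_itv.
  by apply: closed_comp; [move=> y _; exact: norm_continuous | exact: itv_closed].
have [||d d0 dP] :=
  @compact_uniformly_continuous R _ _ A (g \o @direction R n) cA _ N%:R^-1.
- move=> x Ax e e0.
  have [d1 d10 d1P] := within_continuousE gc (direction_sphere (A0 _ Ax)) e0.
  have /cvgrPdist_lt/(_ _ d10) := direction_continuous (A0 _ Ax).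
  move=> /nbhs_ballP[d d0 dP]; exists d => // y Ay xy.
  apply: d1P; first exact/direction_sphere/A0.
  by apply: dP; rewrite -ball_normE.
- by rewrite invr_gt0 ltr0n (leq_ltn_trans _ (ltn_ord i0)).
exists (sphere_vertex hK g i0), d; split=> // [y y0|y y' Ay Ay' yy'].
  exact: sphere_vertexN.
apply: sphere_vertex_near; rewrite ?A0 //; first exact: dP.
by apply: dP; rewrite ?/A /= ?normrN // opprK addrC distrC.
Qed.

End Approximation.

(** * The grid of chords *)

Section Hemisphere.
Local Open Scope ring_scope.
Variable R : realType.

Lemma row_entry_le k (x : 'rV[R]_k) j : `|x ord0 j| <= `|x|.
Proof.
rewrite [leRHS]/Num.norm /= mx_normrE; apply/bigmax_geP; right => /=.
by exists (ord0, j).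
Qed.

Lemma row_norm_le k (x : 'rV[R]_k) M : 0 <= M ->
  (forall j, `|x ord0 j| <= M) -> `|x| <= M.
Proof.
move=> M0 xM; rewrite [leLHS]/Num.norm /= mx_normrE; apply/bigmax_leP; split=> //.
by move=> [i j] _ /=; rewrite ord1.
Qed.

Variable n : nat.
Implicit Types x : 'rV[R]_n.

(** The cube of the sup norm, bent into the upper half of a sphere-like surface;
    the equator is the boundary of the cube, where the map is odd. *)
Definition hemisphere x : 'rV[R]_n.+1 :=
  row_mx (const_mx (1 - `|x|) : 'rV[R]_1) x.

Lemma hemisphere_head x : hemisphere x ord0 ord0 = 1 - `|x|.
Proof.
have <- : (const_mx (1 - `|x|) : 'rV_1) ord0 ord0 = 1 - `|x| by rewrite mxE.
rewrite -(row_mxEl (const_mx (1 - `|x|) : 'rV_1) x).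
by apply: (congr1 (hemisphere x ord0)); apply: val_inj.
Qed.

Lemma hemisphere_tail x j : hemisphere x ord0 (lift ord0 j) = x ord0 j.
Proof.
rewrite -(row_mxEr (const_mx (1 - `|x|) : 'rV_1) x).
by apply: (congr1 (hemisphere x ord0)); apply: val_inj.
Qed.

Lemma hemisphereN x : `|x| = 1 -> hemisphere (- x) = - hemisphere x.
Proof.
move=> x1; apply/rowP => j; rewrite [RHS]mxE.
case: (unliftP ord0 j) => [k|] ->; first by rewrite !hemisphere_tail mxE.
by rewrite !hemisphere_head normrN x1 subrr oppr0.
Qed.

Lemma hemisphere_le1 x : `|x| <= 1 -> `|hemisphere x| <= 1.
Proof.
move=> x1; apply: row_norm_le => // j; case: (unliftP ord0 j) => [k|] ->.
  by rewrite hemisphere_tail (le_trans _ x1) // row_entry_le.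
by rewrite hemisphere_head; have := normr_ge0 x; rewrite ler_norml; lra.
Qed.

Lemma hemisphere_ge x : 2^-1 <= `|hemisphere x|.
Proof.
have h1 := row_entry_le (hemisphere x) ord0; rewrite hemisphere_head in h1.
have : `|x| <= `|hemisphere x|.
  by apply: row_norm_le => // j; rewrite -hemisphere_tail row_entry_le.
by have := ler_norm (1 - `|x|); lra.
Qed.

Lemma hemisphere_lipschitz x x' : `|hemisphere x - hemisphere x'| <= `|x - x'|.
Proof.
apply: row_norm_le => // j; rewrite [X in `|X|]mxE [X in _ + X]mxE.
case: (unliftP ord0 j) => [k|] ->.
  by rewrite !hemisphere_tail; have := row_entry_le (x - x') k; rewrite !mxE.
rewrite !hemisphere_head.
have -> : 1 - `|x| - (1 - `|x'|) = `|x'| - `|x| by lra.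
by rewrite [leRHS]distrC ler_dist_dist.
Qed.

End Hemisphere.

Section GridGeometry.
Local Open Scope ring_scope.
Variables (R : realType) (n r : nat).
Let m := r.*2.+1.
Local Notation cell := (cell (n.*2).+1 m).
Implicit Types (p q v : cell) (S : pred 'I_(n.*2).+1) (a : nat).

Definition block a p : 'rV[R]_n :=
  \row_j (((coordinate p (a + j))%:R - m%:R) / m%:R).

Definition height p : R := (p ord_max)%:R / (m.*2)%:R.

(** The two ends y and z of the chord are obtained for e = 1 and e = -1. *)
Definition chord_end (e : R) p : 'rV[R]_n.+1 :=
  height p *: hemisphere (block n p)
  + (e * (1 - height p)) *: hemisphere (block 0 p).

Let m0 : 0 < m%:R :> R. Proof. by rewrite ltr0n. Qed.

Lemma coordinate_le p k : (coordinate p k <= m.*2)%N.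
Proof. by rewrite /coordinate -ltnS ltn_ord. Qed.

Lemma block_le1 a p : `|block a p| <= 1.
Proof.
apply: row_norm_le => // j.
rewrite !mxE normrM normfV (gtr0_norm m0) ler_pdivrMr //.
rewrite mul1r ler_norml; have := coordinate_le p (a + j).
rewrite -(ler_nat R) -addnn natrD; have := ler0n R (coordinate p (a + j)); lra.
Qed.

Lemma height_ge0 p : 0 <= height p.
Proof. by rewrite divr_ge0 ?ler0n. Qed.

Lemma height_le1 p : height p <= 1.
Proof.
by rewrite ler_pdivrMr ?ltr0n // mul1r ler_nat -ltnS ltn_ord.
Qed.

Lemma block_flip S a p : (a + n <= n.*2)%N ->
  (forall k, (a <= k < a + n)%N -> S (inord k)) ->
  block a (flip S p) = - block a p.
Proof.
move=> an SE; apply/rowP => j; rewrite !mxE coordinate_flip.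
rewrite SE; last by have := ltn_ord j; lia.
rewrite natrB ?coordinate_le // -addnn natrD -mulNr; congr (_ * _).
by rewrite /m; ring.
Qed.

Lemma block_flip_id S a p : (a + n <= n.*2)%N ->
  (forall k, (a <= k < a + n)%N -> S (inord k) = false) ->
  block a (flip S p) = block a p.
Proof.
move=> an SE; apply/rowP => j; rewrite !mxE coordinate_flip.
by rewrite SE //; have := ltn_ord j; lia.
Qed.

Lemma block_boundary S a p : (forall i, S i -> (a <= i < a + n)%N) ->
  on_boundary S p -> `|block a p| = 1.
Proof.
move=> SE /existsP[i /andP[/SE ai pi]]; apply/eqP; rewrite eq_le block_le1 /=.
have jn : (i - a < n)%N by lia.
apply: le_trans (row_entry_le _ (Ordinal jn)).
rewrite mxE /= subnKC; last by lia.
rewrite /coordinate inord_val normrM normfV (gtr0_norm m0) ler_pdivlMr // mul1r.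
case/orP: pi => /eqP->; first by rewrite sub0r normrN gtr0_norm.
by rewrite -addnn natrD addrK gtr0_norm.
Qed.

Lemma height_flip S p : S ord_max = false -> height (flip S p) = height p.
Proof. by rewrite /height flipE => ->. Qed.

Lemma chord_end_flipx e p : on_boundary (@xblock n) p ->
  chord_end e (flip (@xblock n) p) = chord_end (- e) p.
Proof.
move=> bp; rewrite /chord_end height_flip; last by rewrite /xblock /=; lia.
rewrite block_flip_id ?block_flip; try lia.
- rewrite hemisphereN ?scalerN ?mulNr ?scaleNr //.
  by apply: block_boundary bp => i; rewrite /xblock; lia.
- by move=> k kn; rewrite xblock_inord; lia.
- by move=> k kn; rewrite xblock_inord; lia.
Qed.

Lemma chord_end_flipu e p : on_boundary (@ublock n) p ->
  chord_end e (flip (@ublock n) p) = - chord_end (- e) p.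
Proof.
move=> bp; rewrite /chord_end height_flip; last by rewrite /ublock /=; lia.
rewrite block_flip ?block_flip_id; try lia.
- rewrite hemisphereN ?scalerN ?mulNr ?scaleNr ?opprD ?opprK //.
  by apply: block_boundary bp => i; rewrite /ublock; lia.
- by move=> k kn; rewrite ublock_inord; lia.
- by move=> k kn; rewrite ublock_inord; lia.
Qed.

Lemma chord_end_top e p : p ord_max = m.*2 :> nat ->
  chord_end e p = hemisphere (block n p).
Proof.
move=> pt; rewrite /chord_end /height pt divff ?pnatr_eq0 //.
by rewrite subrr mulr0 scale0r addr0 scale1r.
Qed.

Lemma chord_end_bottom e p : p ord_max = 0 :> nat ->
  chord_end e p = e *: hemisphere (block 0 p).
Proof.
by move=> pb; rewrite /chord_end /height pb mul0r subr0 scale0r add0r mulr1.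
Qed.

Lemma chord_end_le1 e p : `|e| = 1 -> `|chord_end e p| <= 1.
Proof.
move=> e1; have h0 := height_ge0 p; have h1 := height_le1 p.
apply: le_trans (ler_normD _ _) _.
rewrite (normrZ (height p) (hemisphere _)) (normrZ (e * _) (hemisphere _)).
rewrite (normrM e) e1 (ger0_norm h0) ger0_norm ?subr_ge0 //.
have := hemisphere_le1 (block_le1 0 p); have := hemisphere_le1 (block_le1 n p); nra.
Qed.

(** The sum and the difference of the two ends are 2 t U and 2 (1 - t) P, where P
    and U have norm at least 1/2. *)
Lemma chord_ends_far p : 2^-1 <= `|chord_end 1 p| + `|chord_end (- 1) p|.
Proof.
have h0 := height_ge0 p; have h1 := height_le1 p.
have := ler_normD (chord_end 1 p) (chord_end (- 1) p).
have := ler_normB (chord_end 1 p) (chord_end (- 1) p).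
have -> : chord_end 1 p + chord_end (- 1) p =
    (2 * height p) *: hemisphere (block n p).
  by apply/rowP => j; rewrite !mxE; ring.
have -> : chord_end 1 p - chord_end (- 1) p =
    (2 * (1 - height p)) *: hemisphere (block 0 p).
  by apply/rowP => j; rewrite !mxE; ring.
rewrite (normrZ (2 * height p) (hemisphere _)).
rewrite (normrZ (2 * (1 - height p)) (hemisphere _)).
rewrite !ger0_norm ?mulr_ge0 ?subr_ge0 //.
have := hemisphere_ge (block 0 p); have := hemisphere_ge (block n p); nra.
Qed.

Lemma corners_close v p q i : corner p v -> corner q v ->
  `|(p i)%:R - (q i)%:R| <= 2 :> R.
Proof.
move=> /forallP/(_ i) pv /forallP/(_ i) qv.
have pq : (p i <= q i + 2)%N && (q i <= p i + 2)%N.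
  by case: (odd (v i)) pv qv; lia.
case/andP: pq; rewrite -!(ler_nat R) !natrD ler_norml => *; lra.
Qed.

Lemma block_close v p q a : (a + n <= n.*2)%N -> corner p v -> corner q v ->
  `|block a p - block a q| <= 2 / m%:R.
Proof.
move=> an pv qv; apply: row_norm_le => [|j]; first by rewrite divr_ge0.
rewrite !mxE -mulrBl normrM normfV (gtr0_norm m0) ler_pM2r ?invr_gt0 //.
by rewrite opprB addrA subrK; apply: corners_close pv qv.
Qed.

Lemma height_close v p q : corner p v -> corner q v ->
  `|height p - height q| <= m%:R^-1.
Proof.
move=> pv qv; rewrite /height -mulrBl normrM normfV.
have /(corners_close _ pv) := qv => /(_ ord_max) pq.
rewrite [X in _ / X]ger0_norm // ler_pdivrMr ?ltr0n //.
have -> : (m.*2)%:R = m%:R * 2 :> R by rewrite -natrM muln2.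
by rewrite mulrA mulVf ?mul1r // gt_eqF.
Qed.

Lemma chord_end_close e v p q : `|e| = 1 -> corner p v -> corner q v ->
  `|chord_end e p - chord_end e q| <= 4 / m%:R.
Proof.
move=> e1 pv qv; rewrite /chord_end.
set t := height p; set t' := height q.
set A := hemisphere (block 0 p); set A' := hemisphere (block 0 q).
set B := hemisphere (block n p); set B' := hemisphere (block n q).
have -> : t *: B + (e * (1 - t)) *: A - (t' *: B' + (e * (1 - t')) *: A') =
  ((e * (1 - t)) *: (A - A') + t *: (B - B'))
  + ((t - t') *: B' - (e * (t - t')) *: A').
  by apply/rowP => j; rewrite !mxE; ring.
have t0 : 0 <= t := height_ge0 p; have t1 : t <= 1 := height_le1 p.
have AA : `|A - A'| <= 2 / m%:R.
  by apply: le_trans (hemisphere_lipschitz _ _) (block_close _ pv qv); lia.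
have BB : `|B - B'| <= 2 / m%:R.
  by apply: le_trans (hemisphere_lipschitz _ _) (block_close _ pv qv); lia.
have A1 : `|A'| <= 1 := hemisphere_le1 (block_le1 0 q).
have B1 : `|B'| <= 1 := hemisphere_le1 (block_le1 n q).
have tt := height_close pv qv; rewrite -/t -/t' in tt.
apply: le_trans (ler_normD _ _) _.
have h1 : `|(e * (1 - t)) *: (A - A') + t *: (B - B')| <= 2 / m%:R.
  apply: le_trans (ler_normD _ _) _.
  rewrite (normrZ (e * (1 - t)) (A - A')) (normrZ t (B - B')).
  by rewrite (normrM e) e1 (ger0_norm t0) ger0_norm ?subr_ge0 //; nra.
have h2 : `|(t - t') *: B' - (e * (t - t')) *: A'| <= 2 / m%:R.
  apply: le_trans (ler_normB _ _) _.
  rewrite (normrZ (t - t') B') (normrZ (e * (t - t')) A') (normrM e) e1.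
  have := normr_ge0 (t - t'); nra.
lra.
Qed.

End GridGeometry.

(** * Linked pairs of vertices *)

Section EqualLabelPaths.
Variables (R : realType) (n N : nat) (K : triangulation R n N).
Variable label : 'I_N -> int.

Definition label_step : rel ('I_N * 'I_N) :=
  [rel a b | [&& near_vertices K a.1 b.1, near_vertices K a.2 b.2
               & label b.1 == label b.2]].

Definition label_linked (a b : 'I_N) : bool :=
  [exists c, connect label_step (c, c) (a, b)].

Lemma label_linkedxx a : label_linked a a.
Proof. by apply/existsP; exists a; apply: connect0. Qed.

Lemma label_linked_step a a' b b' : label_linked a b ->
  near_vertices K a a' -> near_vertices K b b' -> label a' = label b' ->
  label_linked a' b'.
Proof.
move=> /existsP[c cab] aa' bb' ab'; apply/existsP; exists c.
by apply: connect_trans cab (connect1 _); apply/and3P; split=> //=; apply/eqP.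
Qed.

Lemma label_linked_map (f : 'I_N * 'I_N -> 'I_N * 'I_N) a b :
  (forall p q, label_step p q -> label_step (f p) (f q)) ->
  (forall c, exists c', f (c, c) = (c', c')) ->
  label_linked a b -> label_linked (f (a, b)).1 (f (a, b)).2.
Proof.
move=> fstep fdiag /existsP[c /connectP[s sp ->]]; have [c' fc] := fdiag c.
apply/existsP; exists c'; rewrite -surjective_pairing -fc.
apply/connectP; exists (map f s); last by rewrite last_map.
by rewrite path_map; apply: sub_path sp => p q; apply: fstep.
Qed.

Lemma label_linked_sym a b : label_linked a b -> label_linked b a.
Proof.
apply: (label_linked_map (f := fun p => (p.2, p.1))); last by move=> c; exists c.
by move=> p q /and3P[h1 h2 h3]; apply/and3P; split; rewrite //= eq_sym.
Qed.

Lemma label_linked_antipode (hK : tucker_triangulation K label)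
    (g : 'rV[R]_n.+1 -> 'rV[R]_N) a b :
  (forall x, realization K x -> g (param K x) = x) ->
  label_linked a b -> label_linked (antipode hK a) (antipode hK b).
Proof.
pose f (p : 'I_N * 'I_N) := (antipode hK p.1, antipode hK p.2).
move=> gK; apply: (label_linked_map (f := f)).
  move=> p q /and3P[h1 h2 /eqP h3]; apply/and3P.
  split=> /=; [exact: (near_antipode hK gK h1)|exact: (near_antipode hK gK h2)|].
  by rewrite !label_antipode h3.
by move=> c; exists (antipode hK c).
Qed.

Lemma label_linked_paths a b : label_linked a b ->
  exists (l : nat) (v w : l.+1.-tuple 'I_N),
    [/\ edge_path K v /\ edge_path K w, tnth v ord0 = tnth w ord0,
        tnth v ord_max = a /\ tnth w ord_max = b &
        forall t, label (tnth v t) = label (tnth w t)].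
Proof.
move=> /existsP[c /connectP[s sp sl]].
pose sq := (c, c) :: s.
have sv (f : 'I_N * 'I_N -> 'I_N) : size (map f sq) == (size s).+1.
  by rewrite size_map.
exists (size s), (Tuple (sv fst)), (Tuple (sv snd)); split.
- have ep (f : 'I_N * 'I_N -> 'I_N) :
      (forall p q, label_step p q -> near_vertices K (f p) (f q)) ->
      edge_path K (map f sq).
    move=> fP; rewrite /edge_path sorted_map /=.
    by apply: sub_path sp => p q /fP.
  by split; apply: ep => p q /and3P[].
- by rewrite !(tnth_nth c).
- have lastE (f : 'I_N * 'I_N -> 'I_N) : nth c (map f sq) (size s) = f (a, b).
    by rewrite (nth_map (c, c)) // sl (last_nth (c, c)).
  by rewrite !(tnth_nth c); split; exact: lastE.
move=> t; rewrite !(tnth_nth c) [val]/= !(nth_map (c, c)) //.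
have : all (fun p => label p.1 == label p.2) sq.
  rewrite /= eqxx /=; elim: s (c, c) sp {sl sq sv t} => //= p s IHs q.
  move=> /andP[/and3P[_ _ ->]].
  exact: IHs.
by move=> /all_nthP-/(_ (c, c) t (ltn_ord t))/eqP.
Qed.

End EqualLabelPaths.

(** * The two paths *)

Section LinkedAntipodes.
Local Open Scope ring_scope.
Variables (R : realType) (n N : nat) (hn : (0 < n)%N) (K : triangulation R n N).
Variables (label : 'I_N -> int) (hK : tucker_triangulation K label).

(** The mesh is chosen so that the ends of chords move by less than 1/16, and by
    less than the modulus of the approximation, within a cell; the neighborhoods
    of the origin have radius 1/16 and 1/8.  A linked cell of the bottom face
    gives a linked pair whose second member is the antipode of a vertex near the
    first. *)
Lemma linked_complementary :
  exists a b, [/\ label_linked K label a b & near_vertices K a (antipode hK b)].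
Proof.
have [_ _ [g [_ gK]]] := param_homeo K.
have e0 : 0 < 1 / 16 :> R by lra.
have [phi [d [d0 phiN phi_near]]] := equivariant_approximation hK e0.
have [labP _ _] := hK.
pose c : R := Num.min d (1 / 16).
have c0 : 0 < c by rewrite lt_min d0; lra.
pose r := Num.bound (4 / c).
pose m := r.*2.+1.
have mc : 4 / m%:R < c.
  have := archi_boundP (ltW (divr_gt0 (ltr0n R 4) c0)); rewrite -/r => rc.
  rewrite ltr_pdivrMr ?ltr0n // mulrC -ltr_pdivrMr //; apply: lt_le_trans rc _.
  by rewrite ler_nat /m; lia.
have [md m16] : 4 / m%:R < d /\ 4 / m%:R < 1 / 16 :> R.
  by move: mc; rewrite lt_min => /andP.
pose y (e : R) (p : cell (n.*2).+1 m) := chord_end e p.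
have close e v p q : `|e| = 1 -> corner p v -> corner q v ->
    `|y e p - y e q| < d /\ `|y e p| <= `|y e q| + 1 / 16.
  move=> e1 pv qv.
  have h : `|y e p - y e q| <= 4 / m%:R := chord_end_close e1 pv qv.
  split; first exact: le_lt_trans h md.
  have := ler_normD (y e p - y e q) (y e q); rewrite subrK => h'.
  by apply: le_trans h' _; rewrite addrC lerD2l; apply: le_trans h (ltW m16).
have n1 : `|1 : R| = 1 by rewrite normr1.
have nN1 : `|-1 : R| = 1 by rewrite normrN normr1.
have far p : 2^-1 <= `|y 1 p| + `|y (- 1) p| := chord_ends_far R p.
have nz e p : 1 / 16 <= `|y e p| -> y e p != 0.
  by move=> yp; rewrite -normr_gt0; lra.
have [|||||||||||||||||||v [vb sv /linkedP[p [q [pv qv lpq]]]]] :=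
  @linked_bottom n r _ label hn labP
  (fun p => phi (y 1 p)) (fun p => phi (y (- 1) p))
  (fun p => `|y 1 p| < 1 / 16) (fun p => `|y (- 1) p| < 1 / 16)
  (fun p => `|y 1 p| < 1 / 8) (fun p => `|y (- 1) p| < 1 / 8)
  (antipode hK) (near_vertices K) (label_linked K label).
- exact: (antipodeK hK gK).
- exact: label_antipode.
- exact: label_linkedxx.
- exact: label_linked_step.
- exact: label_linked_sym.
- by move=> a b; apply: label_linked_antipode gK.
- by move=> v p q pv qv /= yp; have [_] := close 1 v q p n1 qv pv; lra.
- by move=> v p q pv qv /= yp; have [_] := close (- 1) v q p nN1 qv pv; lra.
- move=> v p q pv qv /= yp zq; have := far p.
  by have [_] := close (- 1) v p q nN1 pv qv; lra.
- move=> v p q pv qv sv; apply: phi_near; last by have [] := close 1 v p q n1 pv qv.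
    have [/= + _] := regular_corner sv pv; rewrite -leNgt => ->.
    exact: chord_end_le1.
  have [/= + _] := regular_corner sv qv; rewrite -leNgt => ->.
  exact: chord_end_le1.
- move=> v p q pv qv sv.
  apply: phi_near; last by have [] := close (- 1) v p q nN1 pv qv.
    have [/= _ +] := regular_corner sv pv; rewrite -leNgt => ->.
    exact: chord_end_le1.
  have [/= _ +] := regular_corner sv qv; rewrite -leNgt => ->.
  exact: chord_end_le1.
- by move=> p bp; rewrite /y chord_end_flipx.
- by move=> p bp; rewrite /y chord_end_flipx.
- by move=> p bp; rewrite /y chord_end_flipx.
- move=> p bp /=; rewrite -leNgt => zp; rewrite /y chord_end_flipu // phiN //.
  exact: nz.
- by move=> p bp; rewrite /y chord_end_flipu // normrN.
- by move=> p bp; rewrite /y chord_end_flipu // normrN.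
- by move=> p pt; rewrite /y !chord_end_top.
- move=> p pt; rewrite /y !chord_end_top // -!leNgt.
  by have := hemisphere_ge (block R n p); split; lra.
have bottom p' : corner p' v -> y 1 p' = hemisphere (block R 0 p') /\
    y (- 1) p' = - y 1 p'.
  move=> /forallP/(_ ord_max); rewrite vb => p'b.
  have {}p'b : p' ord_max = 0 :> nat by move: p'b => /=; lia.
  by rewrite /y !chord_end_bottom // scale1r scaleN1r.
have [yq zq] := bottom q qv.
have yq0 : y 1 q != 0.
  by rewrite yq -normr_gt0; have := hemisphere_ge (block R 0 q); lra.
exists (phi (y 1 p)), (phi (y (- 1) q)); split=> //.
rewrite zq phiN // (antipodeK hK gK); apply: phi_near.
- have [/= + _] := regular_corner sv pv; rewrite -leNgt => ->.
  exact: chord_end_le1.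
- have [/= + _] := regular_corner sv qv; rewrite -leNgt => ->.
  exact: chord_end_le1.
- by have [] := close 1 v p q n1 pv qv.
Qed.

End LinkedAntipodes.

Theorem theorem6 (R : realType) (n N : nat) (hn : (0 < n)%N)
    (K : triangulation R n N) (label : 'I_N -> int)
    (hK : tucker_triangulation K label) :
  exists (m : nat) (v w : m.+1.-tuple 'I_N),
    [/\ edge_path K v /\ edge_path K w,
        antipodal K (tnth v ord0) (tnth w ord0),
        complementary_edge K label (tnth v ord_max) (tnth w ord_max) &
        forall t : 'I_m.+1,
          tucker_pair K label (vertex K (tnth v t)) (vertex K (tnth w t))].
Proof.
have [_ _ [g [_ gK]]] := param_homeo K; have [labP _ _] := hK.
have [a [b [lab_ab ab]]] := linked_complementary hn hK.
have [l [v [w [[pv pw] vw0 [va wb] vw]]]] := label_linked_paths lab_ab.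
have opp t : (label (tnth v t) + label (tnth (map_tuple (antipode hK) w) t) = 0)%R.
  by rewrite tnth_map label_antipode vw subrr.
exists l, v, (map_tuple (antipode hK) w); split.
- split=> //; rewrite /edge_path sorted_map; apply: sub_sorted pw => c d cd.
  exact: (near_antipode hK gK cd).
- by rewrite tnth_map vw0; apply: antipodeP.
- split; last exact: opp.
  rewrite va tnth_map wb; case/orP: ab => // /eqP ab.
  have := opp ord_max; rewrite tnth_map wb va -ab => h.
  by have := labP a; lia.
- by move=> t; left; exists (tnth v t), (tnth (map_tuple (antipode hK) w) t).
Qed.
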